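(* Let $K$ be the $d$-dimensional level-$l$ Sierpinski gasket with $d\ge2$, $l\ge2$, and let $(\mathcal{E},\mathcal{F})$ be the Dirichlet form on $L^2(K,\mu)$ associated with the canonical harmonic structure $(D,\boldsymbol{r})$, $\mu$ being the normalized Hausdorff measure. Assume that $(\mathcal{E},\mathcal{F})$ is nondegenerate. Then every nonconstant harmonic function $h$ belongs to $\mathcal{F}_{\mathrm{dom}}$, that is, its energy measure $\nu_h$ is a minimal energy-dominant measure. In particular, for any nonconstant harmonic functions $h_1$ and $h_2$, $\nu_{h_1}$ and $\nu_{h_2}$ are mutually absolutely continuous.
   Context: **Gasket.** Let $q_1,\dots,q_{d+1}$ be the vertices of a regular simplex in $\mathbb{R}^d$. The $d$-dimensional level-$l$ Sierpinski gasket $K$ is the unique nonempty compact set with $K=\bigcup_{\alpha}\psi_\alpha(K)$, where $\alpha=(\alpha_1,\dots,\alpha_{d+1})$ ranges over nonnegative integer vectors with $\sum_j\alpha_j=l-1$ and $\psi_\alpha(x)=\frac1l\big(x+\sum_j\alpha_jq_j\big)$. The maps are relabelled $\{\psi_i\}_{i\in S}$ with $S\subset\mathbb{N}$ finite containing $1,\dots,d+1$, so that $q_i$ is the fixed point of $\psi_i$ for $i=1,\dots,d+1$. $V_0=\{q_1,\dots,q_{d+1}\}$. For $w=w_1\cdots w_m\in S^m$, $\psi_w=\psi_{w_1}\circ\cdots\circ\psi_{w_m}$ ($\psi_\emptyset=\mathrm{id}$); $V_m=\bigcup_{w\in S^m}\psi_w(V_0)$. **Canonical harmonic structure and Dirichlet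 form.** For a finite set $V$, $l(V)$ is the space of real functions on $V$ with inner product $(u,v)_{l(V)}=\sum_{q\in V}u(q)v(q)$. The matrix $D=(D_{qq'})_{q,q'\in V_0}$ has $D_{qq}=-cd$ and $D_{qq'}=c$ for $q\ne q'$, for some $c>0$. $\boldsymbol{r}=(r_i)_{i\in S}$ has $0<r_i<1$, is invariant under the symmetries of the simplex (acting on the cells $\psi_i(K)$), in particular $r_1=\dots=r_{d+1}=r$ for some $r\in(0,1)$, and $(D,\boldsymbol{r})$ is a harmonic structure in the following sense. Put $\mathcal{E}^{(0)}(u,v)=(-Du,v)_{l(V_0)}$ and, with $r_w=r_{w_1}\cdots r_{w_m}$ ($r_\emptyset=1$), $\mathcal{E}^{(m)}(u,v)=\sum_{w\in S^m}r_w^{-1}\mathcal{E}^{(0)}(u\circ\psi_w|_{V_0},v\circ\psi_w|_{V_0})$ on $l(V_m)$; then $\mathcal{E}^{(0)}(v,v)=\inf\{\mathcal{E}^{(1)}(u,u):u\in l(V_1),u|_{V_0}=v\}$ for all $v\in l(V_0)$. With $\mu$ the normalized Hausdorff measure on $K$, $\mathcal{F}=\{u\in C(K):\lim_m\mathcal{E}^{(m)}(u|_{V_m},u|_{V_m})<\infty\}$ and $\mathcal{E}(u,v)=\lim_m\mathcal{E}^{(m)}(u|_{V_m},v|_{V_m})$ define a strong local regular Dirichlet form on $L^2(K,\mu)$; $\mathcal{E}(f)=\mathcal{E}(f,f)$. **Harmonic functions and nondegeneracy.** For $u\in l(V_0)$ there is a unique $h=\iota(u)\in\mathcal{F}$ with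 $h|_{V_0}=u$ minimizing $\mathcal{E}$ among functions in $\mathcal{F}$ with boundary value $u$; such $h$ are called harmonic, and $\mathcal{H}=\iota(l(V_0))$. If $h\in\mathcal{H}$ then $h\circ\psi_i\in\mathcal{H}$. Define $A_i:l(V_0)\to l(V_0)$ by $A_iu=(\iota(u)\circ\psi_i)|_{V_0}$. $(\mathcal{E},\mathcal{F})$ is nondegenerate if $A_i$ is bijective for every $i\in S$. **Energy measures.** For $f\in\mathcal{F}$, $\nu_f$ is the finite positive Borel measure with $\int_K\varphi\,d\nu_f=2\mathcal{E}(f\varphi,f)-\mathcal{E}(\varphi,f^2)$ for all $\varphi\in\mathcal{F}$. A $\sigma$-finite Borel measure $\nu$ is a minimal energy-dominant measure if (i) $\nu_f\ll\nu$ for all $f\in\mathcal{F}$ and (ii) any $\sigma$-finite Borel $\nu'$ satisfying (i) in place of $\nu$ has $\nu\ll\nu'$. $\mathcal{F}_{\mathrm{dom}}$ is the set of $f\in\mathcal{F}$ such that $\nu_f$ is a minimal energy-dominant measure. *)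

(* Defs.v *)
From HB Require Import structures.
From mathcomp Require Import all_boot all_order all_algebra.
From mathcomp Require Import all_classical all_reals all_analysis.
Set Implicit Arguments.
Unset Strict Implicit.
Unset Printing Implicit Defensive.
Import Order.TTheory GRing.Theory Num.Theory.
Import numFieldNormedType.Exports.
Local Open Scope classical_set_scope.
Local Open Scope ring_scope.

(* MathComp-Analysis.  The topology of 'rV[R]_d is the product topology, i.e.
   the usual one of R^d; the library norm on 'rV[R]_d is the sup norm, so the
   Euclidean distance is defined here. *)
Definition edist (R : realType) (d : nat) (x y : 'rV[R]_d) : R :=
  Num.sqrt (\sum_k (x 0 k - y 0 k) ^+ 2).

(* d + 1 mutually equidistant distinct points of R^d; they are automatically
   affinely independent. *)
Definition regular_simplex (R : realType) (d : nat)
    (q : 'I_d.+1 -> 'rV[R]_d) : Prop :=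
  exists2 s : R, 0 < s & forall i j, i != j -> edist (q i) (q j) = s.

(* The index set S: the multi-indices alpha with |alpha| = l - 1 (each entry is
   then < l).  The vertex q_j is the fixed point of psi_alpha for alpha equal to
   l - 1 at j and 0 elsewhere. *)
Definition label (d l : nat) : finType :=
  {a : {ffun 'I_d.+1 -> 'I_l} | (\sum_j (a j : nat) == l.-1)%N}.

Section Gasket.
Context (R : realType) (d l : nat).
Local Notation V := 'rV[R]_d.
Local Notation S := (label d l).
Implicit Types (q : 'I_d.+1 -> V) (K : set V) (r : S -> R) (c : R).

Definition psi q (a : S) (x : V) : V :=
  l%:R^-1 *: (x + \sum_j (val a j)%:R *: q j).

Definition psiw q (w : seq S) : V -> V :=
  foldr (fun a f => psi q a \o f) id w.

Definition is_gasket q K : Prop :=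
  [/\ K !=set0, compact K & K = \bigcup_(a in [set: S]) (psi q a @` K)].

Definition simplex_symmetry q (T : V -> V) : Prop :=
  (forall x y, edist (T x) (T y) = edist x y) /\ T @` range q = range q.

(* Functions on V_0, V_m and K are represented as follows: l(V_0) is
   'I_d.+1 -> R, the vertex q_j being replaced by its index j; functions on V_m
   or K are restrictions of functions on R^d, and nothing below depends on
   their values outside V_m, resp. K. *)
Definition Dmx c : 'M[R]_d.+1 :=
  \matrix_(i, j) (if i == j then - (c * d%:R) else c).

Definition energy0 c (u v : 'I_d.+1 -> R) : R :=
  \sum_i (- \sum_j Dmx c i j * u j) * v i.

Definition weight r (w : seq S) : R := \prod_(a <- w) r a.

Definition energyn q c r (m : nat) (u v : V -> R) : R :=
  \sum_(w : m.-tuple S)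
    (weight r w)^-1 * energy0 c (u \o psiw q w \o q) (v \o psiw q w \o q).

Definition canonical_harmonic_structure q K c r : Prop :=
  [/\ 0 < c,
      forall a, 0 < r a < 1,
      forall T a b, simplex_symmetry q T ->
        T @` (psi q a @` K) = psi q b @` K -> r a = r b
    & forall v : 'I_d.+1 -> R,
        energy0 c v v =
        inf [set energyn q c r 1 u u | u in [set u : V -> R | u \o q = v]]].

(* u \in C(K) with lim_m E^(m)(u, u) finite.  The reference measure mu plays no
   role: neither the form nor the notions below depend on it. *)
Definition domF q K c r : set (V -> R) :=
  [set u | {within K, continuous u} /\ cvgn (fun m => energyn q c r m u u)].

Definition energy q c r (u v : V -> R) : R :=
  limn (fun m => energyn q c r m u v).

Definition harmonic_function q K c r (h : V -> R) : Prop :=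
  domF q K c r h /\
  forall g, domF q K c r g -> g \o q = h \o q ->
    energy q c r h h <= energy q c r g g.

(* The harmonic extension is unique only on K; [xget] selects one of its
   representatives on R^d. *)
Definition iota_ext q K c r (u : 'I_d.+1 -> R) : V -> R :=
  xget (fun=> 0) [set h | harmonic_function q K c r h /\ h \o q = u].

Definition Amap q K c r (a : S) (u : 'I_d.+1 -> R) : 'I_d.+1 -> R :=
  iota_ext q K c r u \o psi q a \o q.

Definition nondegenerate_form q K c r : Prop :=
  forall a, bijective (Amap q K c r a).

Definition nonconstant_on K (h : V -> R) : Prop :=
  ~ exists b : R, forall x, K x -> h x = b.

(* R^d with its Borel sigma-algebra.  Borel measures on K are represented as
   Borel measures on R^d that vanish outside K. *)
Definition borelV : measurableType _ := g_sigma_algebraType (@open V).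

Definition carried K (nu : set borelV -> \bar R) : Prop := nu (~` K) = 0%E.

Definition is_energy_measure q K c r (f : V -> R)
    (nu : {finite_measure set borelV -> \bar R}) : Prop :=
  carried K nu /\
  forall phi : V -> R, domF q K c r phi ->
    (\int[nu]_(x in K) (phi x)%:E)%E =
    (2 * energy q c r (f \* phi) f - energy q c r phi (f \* f))%:E.

(* A family of measures indexed by functions: below, [nu f] is the energy
   measure of f for every f in the domain (its values elsewhere are irrelevant). *)
Implicit Type nu : (V -> R) -> {finite_measure set borelV -> \bar R}.

Definition energy_dominant q K c r nu (m : set borelV -> \bar R) : Prop :=
  forall f, domF q K c r f -> nu f `<< m.

Definition minimal_energy_dominant q K c r nu
    (m : {sigma_finite_measure set borelV -> \bar R}) : Prop :=
  [/\ carried K m, energy_dominant q K c r nu m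
    & forall m' : {sigma_finite_measure set borelV -> \bar R},
        carried K m' -> energy_dominant q K c r nu m' -> m `<< m'].

Definition Fdom q K c r nu : set (V -> R) :=
  [set f | domF q K c r f /\ minimal_energy_dominant q K c r nu (nu f)].

End Gasket.

(* Main.v *)
Require Import Defs.
From HB Require Import structures.
From mathcomp Require Import all_boot all_order all_algebra.
From mathcomp Require Import all_classical all_reals all_analysis.
From mathcomp Require Import measurable_realfun perm zify ring lra.
Set Implicit Arguments.
Unset Strict Implicit.
Unset Printing Implicit Defensive.
Import Order.TTheory GRing.Theory Num.Theory.
Import numFieldNormedType.Exports.
Local Open Scope classical_set_scope.
Local Open Scope ring_scope.

(* Write [A_a] for the map sending boundary values [u] to those of the harmonic
   extension of [u] read in the cell [a], and [A_w] for the composites.  If [f]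
   and [g] are harmonic and [nu g] vanishes on [B], the Cauchy-Schwarz inequality
   for the mutual energy measure of [f] and [g], on each cell, bounds the numbers
   [E0 (A_w u) (A_w v)] by [nu f (~` B)].  At a vertex cell the symmetry group
   reduces [A_a] to two scalars, and the words of length at most 2 already
   suffice to bound [E0 u u * E0 v v] by the squares of these numbers; hence
   [nu f K <= C * nu f (~` B)] as soon as [g] is not constant.  By self-similarity
   and nondegeneracy the same holds inside every cell, with the same [C].  As Borel
   sets are approximated by unions of cells, this forces [nu f B = 0].  Functions
   of the domain are reached by approximation by piecewise harmonic ones. *)

(** The comparison has to hold with one constant for all cells and all pairs [f], [g], since it is
    applied in ever smaller cells before a limit is taken. Two letters suffice for the following
    reason. Let [x] and [y] be the centred boundary values of [u] and [v]. Modulo constants, the map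
    at vertex [i] has two eigenvalues, so one letter [i] isolates the product [x_i y_i]. A letter
    [i] followed by a letter [j] mixes the two coordinates and gives [x_i y_j + x_j y_i]. The
    squares of these sums add up to at least [2 |x|^2 |y|^2]. Nondegeneracy enters three times: it
    yields the harmonic extensions, it makes the smaller eigenvalue nonzero, and it keeps a
    nonconstant [g] nonconstant in every cell. The gasket is known only through compactness and its
    self-similarity equation, so its geometry (position in the simplex, vertices, overlaps of cells)
    is read off from barycentric coordinates, mostly at points where they are extremal. *)

Lemma sum_tupleS (T : finType) (M : nmodType) m (F : seq T -> M) :
  \sum_(w : m.+1.-tuple T) F w = \sum_a \sum_(w : m.-tuple T) F (a :: w).
Proof.
rewrite pair_bigA /= (reindex (fun p : T * m.-tuple T => [tuple of p.1 :: p.2])) //=.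
exists (fun w => (thead w, [tuple of behead w])) => [[a w] _|w _] /=.
  by rewrite theadE; congr pair; apply/val_inj.
by rewrite [RHS]tuple_eta; apply/val_inj.
Qed.

Lemma sum_tuple0 (T : finType) (M : nmodType) (F : seq T -> M) :
  \sum_(w : 0.-tuple T) F w = F [::].
Proof. by rewrite (big_pred1 [tuple]) // => w; apply/esym/eqP; rewrite [LHS]tuple0. Qed.

Lemma clamp_contract (R : realType) (x y : R) :
  `|Num.max 0 (Num.min 1 x) - Num.max 0 (Num.min 1 y)| <= `|x - y|.
Proof.
suff H (a b : R) : a <= b ->
    0 <= Num.max 0 (Num.min 1 b) - Num.max 0 (Num.min 1 a) <= b - a.
  have [xy|/ltW yx] := leP x y.
    have /andP[? ?] := H _ _ xy; rewrite distrC (distrC x) !ger0_norm//; lra.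
  have /andP[? ?] := H _ _ yx; rewrite !ger0_norm//; lra.
move=> ab; have [a1|a1] := leP 1 a; have [b1|b1] := leP 1 b; try lra.
- by rewrite [Num.max 0 1]max_r//; case: (leP 0 a) => a0; apply/andP; split; lra.
- by case: (leP 0 a) => a0; case: (leP 0 b) => b0; apply/andP; split; lra.
Qed.

Lemma quad_min (R : realType) (b e : R) : 0 <= e ->
  (forall t, 0 <= 2 * t * b + t ^+ 2 * e) -> b = 0.
Proof.
(* [e] may vanish, so the test value is [- b / (e + 1)] rather than the minimizer [- b / e]. *)
move=> e0 H; have := H (- b / (e + 1)).
have e10 : e + 1 != 0 by rewrite gt_eqF// ltr_wpDl.
have -> : 2 * (- b / (e + 1)) * b + (- b / (e + 1)) ^+ 2 * e =
    - (b ^+ 2 * ((e + 2) / (e + 1) ^+ 2)) by field.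
rewrite oppr_ge0 => H1; apply/eqP; rewrite -sqrf_eq0; apply/eqP/le_anti.
rewrite sqr_ge0 andbT -(pmulr_lle0 _ (x := (e + 2) / (e + 1) ^+ 2)) //.
by rewrite divr_gt0 ?exprn_gt0 ?ltr_wpDl.
Qed.

Lemma quad_discr (R : realType) (a b e : R) : 0 <= a -> 0 <= e ->
  (forall t, 0 <= a + 2 * t * b + t ^+ 2 * e) -> b ^+ 2 <= a * e.
Proof.
move=> a0; rewrite le_eqVlt => /predU1P[<-|e0] H.
  have [->|b0] := eqVneq b 0; first by rewrite mulr0 expr0n.
  (* For [e = 0] the polynomial is affine with slope [2 * b], and this [t] gives it the value
     [-1]. *)
  have := H (- (a + 1) / (2 * b)).
  have -> : a + 2 * (- (a + 1) / (2 * b)) * b + (- (a + 1) / (2 * b)) ^+ 2 * 0 = -1 by field.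
  by rewrite lerNr oppr0 ler10.
have := H (- b / e).
have -> : a + 2 * (- b / e) * b + (- b / e) ^+ 2 * e = (a * e - b ^+ 2) / e.
  by field; rewrite gt_eqF.
by rewrite pmulr_lge0 ?invr_gt0// subr_ge0.
Qed.

Section Gasket.
Context (R : realType) (d l : nat) (q : 'I_d.+1 -> 'rV[R]_d)
  (K : set 'rV[R]_d) (c : R) (r : label d l -> R).
Local Notation V := 'rV[R]_d.
Local Notation S := (label d l).
Local Notation E0 := (@energy0 R d c).
Local Notation En := (energyn q c r).
Local Notation E := (energy q c r).
Local Notation F := (domF q K c r).

(** * Discrete energies *)

Lemma energy0E (u v : 'I_d.+1 -> R) :
  E0 u v = c * (d.+1%:R * (\sum_i u i * v i) - (\sum_i u i) * (\sum_i v i)).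
Proof.
rewrite mulrBr [d.+1%:R * _]mulr_sumr [(\sum_i u i) * _]mulr_sumr.
rewrite 2!mulr_sumr -sumrB; apply: eq_bigr => i _.
rewrite (bigD1 i) //= mxE eqxx; under eq_bigr => j /negbTE ji.
  by rewrite mxE eq_sym ji; over.
by rewrite -mulr_sumr (bigD1 i (P := xpredT) (F := u)) //=; ring.
Qed.

Lemma energy0_sumsq (u v : 'I_d.+1 -> R) :
  E0 u v = c / 2 * \sum_i \sum_j (u i - u j) * (v i - v j).
Proof.
transitivity (c / 2 * \sum_i (d.+1%:R * (u i * v i) - u i * (\sum_j v j)
   - (\sum_j u j) * v i + \sum_j u j * v j)); last first.
  congr (_ * _); apply: eq_bigr => i _.
  rewrite [RHS](eq_bigr (fun j => u i * v i - u i * v j - u j * v i + u j * v j));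
    last by move=> j _; ring.
  rewrite big_split /= !sumrB sumr_const card_ord mulr_natl.
  by rewrite -mulr_sumr -mulr_suml.
rewrite big_split /= !sumrB sumr_const card_ord -mulr_natl -mulr_sumr -mulr_suml.
by rewrite -mulr_sumr energy0E; field.
Qed.

Lemma energy0C u v : E0 u v = E0 v u.
Proof.
rewrite !energy0E [_ * (\sum_i v i)]mulrC.
by under eq_bigr do rewrite mulrC.
Qed.

Lemma energy0_ge0 u : 0 <= c -> 0 <= E0 u u.
Proof.
move=> c0; rewrite energy0_sumsq mulr_ge0 ?divr_ge0//.
by do 2!apply: sumr_ge0 => ? _; rewrite -expr2 sqr_ge0.
Qed.

Lemma energy0Dl t u u' v : E0 (fun i => u i + t * u' i) v = E0 u v + t * E0 u' v.
Proof.
rewrite !energy0_sumsq [t * _]mulrCA -mulrDr; congr (_ * _).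
rewrite mulr_sumr -big_split /=; apply: eq_bigr => i _.
rewrite mulr_sumr -big_split; apply: eq_bigr => j _ /=.
by ring.
Qed.

Lemma energy0_const b u : E0 (fun=> b) u = 0.
Proof.
by rewrite energy0_sumsq; do 2![rewrite big1 ?mulr0// => ? _]; rewrite subrr mul0r.
Qed.

Lemma energy0_eq0 u : 0 < c -> E0 u u = 0 -> forall i j, u i = u j.
Proof.
move=> c0 /eqP; rewrite energy0_sumsq mulf_eq0 gt_eqF ?divr_gt0//= => /eqP H i j.
have Q i' j' : 0 <= (u i' - u j') * (u i' - u j') by rewrite -expr2 sqr_ge0.
have := @psumr_eq0P _ _ _ _ (fun i _ => sumr_ge0 _ (fun j _ => Q i j)) H i isT.
move=> {}H; have /eqP := @psumr_eq0P _ _ _ _ (fun j _ => Q i j) H j isT.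
by rewrite -expr2 sqrf_eq0 subr_eq0 => /eqP.
Qed.

Lemma energynS m f g :
  En m.+1 f g = \sum_a (r a)^-1 * En m (f \o psi q a) (g \o psi q a).
Proof.
pose G w := (weight r w)^-1 * E0 (f \o psiw q w \o q) (g \o psiw q w \o q).
rewrite [LHS](sum_tupleS m G); apply: eq_bigr => a _.
rewrite mulr_sumr; apply: eq_bigr => w _.
by rewrite /G /weight big_cons invfM mulrA.
Qed.

Lemma energyn0 f g : En 0 f g = E0 (f \o q) (g \o q).
Proof.
pose G w := (weight r w)^-1 * E0 (f \o psiw q w \o q) (g \o psiw q w \o q).
by rewrite [LHS](sum_tuple0 G) /G /weight big_nil invr1 mul1r.
Qed.

Lemma energynC m f g : En m f g = En m g f.
Proof. by apply: eq_bigr => w _; rewrite energy0C. Qed.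

Lemma energynDl m t f f' g :
  En m (fun x => f x + t * f' x) g = En m f g + t * En m f' g.
Proof.
rewrite mulr_sumr -big_split; apply: eq_bigr => w _ /=.
by rewrite energy0Dl; ring.
Qed.

Lemma energynDr m t f f' g :
  En m g (fun x => f x + t * f' x) = En m g f + t * En m g f'.
Proof. by rewrite ![En m g _]energynC energynDl. Qed.

Lemma energyn_const m b g : En m (fun=> b) g = 0.
Proof. by rewrite /energyn big1// => w _; rewrite energy0_const mulr0. Qed.

(** * Geometry of the simplex and of the gasket *)

Context (hd : (2 <= d)%N) (hl : (2 <= l)%N) (s : R) (s0 : 0 < s)
  (hs : forall i j, i != j -> Defs.edist (q i) (q j) = s) (hK : is_gasket l q K).

Definition dot (x y : V) : R := \sum_k x 0 k * y 0 k.

Lemma dotC x y : dot x y = dot y x.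
Proof. by apply: eq_bigr => k _; rewrite mulrC. Qed.

Lemma dotDl x y z : dot (x + y) z = dot x z + dot y z.
Proof. by rewrite -big_split; apply: eq_bigr => k _; rewrite mxE mulrDl. Qed.

Lemma dotZl t x z : dot (t *: x) z = t * dot x z.
Proof. by rewrite mulr_sumr; apply: eq_bigr => k _; rewrite mxE mulrA. Qed.

Lemma dotNl x z : dot (- x) z = - dot x z.
Proof. by rewrite -scaleN1r dotZl mulN1r. Qed.

Lemma dotBl x y z : dot (x - y) z = dot x z - dot y z.
Proof. by rewrite dotDl dotNl. Qed.

Lemma dot_suml (I : finType) (f : I -> V) z :
  dot (\sum_i f i) z = \sum_i dot (f i) z.
Proof.
rewrite exchange_big; apply: eq_bigr => k _.
by rewrite summxE mulr_suml.
Qed.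

Lemma dotZr t x z : dot z (t *: x) = t * dot z x.
Proof. by rewrite !(dotC z) dotZl. Qed.

Lemma dotBr x y z : dot z (x - y) = dot z x - dot z y.
Proof. by rewrite !(dotC z) dotBl. Qed.

Lemma dot_sumr (I : finType) (f : I -> V) z :
  dot z (\sum_i f i) = \sum_i dot z (f i).
Proof. by rewrite dotC dot_suml; apply: eq_bigr => i _; rewrite dotC. Qed.

Lemma edist_dot (x y : V) : Defs.edist x y = Num.sqrt (dot (x - y) (x - y)).
Proof. by congr Num.sqrt; apply: eq_bigr => k _; rewrite !mxE expr2. Qed.

Lemma dot_continuous z : continuous (fun x : V => dot x z).
Proof.
apply: (continuous_big add_continuous) => k _ x.
by apply: continuousM; [exact: coord_continuous|exact: cst_continuous].
Qed.

Lemma simplex_side i j : dot (q i - q j) (q i - q j) = s ^+ 2 * (i != j)%:R.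
Proof.
have dot_ge0 x : 0 <= dot x x by apply: sumr_ge0 => k _; rewrite -expr2 sqr_ge0.
case: eqVneq => [->|ij] /=.
  by rewrite subrr mulr0 /dot big1// => k _; rewrite mxE mul0r.
by rewrite mulr1 -(hs ij) edist_dot sqr_sqrtr.
Qed.

Lemma d1_neq0 : 1 + d%:R != 0 :> R.
Proof. by rewrite nat1r pnatr_eq0. Qed.

Definition centroid : V := d.+1%:R^-1 *: \sum_k q k.

(* The barycentric coordinates: since the simplex is regular,
   [bary i x = 1 / (d + 1) + (avg_k |x - q k|^2 - |x - q i|^2) / s^2],
   in which the quadratic part cancels. *)
Definition bary (i : 'I_d.+1) (x : V) : R :=
  d.+1%:R^-1 + s ^- 2 *
    (d.+1%:R^-1 * (\sum_k dot (q k) (q k)) - dot (q i) (q i))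
  + 2 * s ^- 2 * dot x (q i - centroid).

Lemma baryE i x : bary i x = d.+1%:R^-1 + s ^- 2 *
  (d.+1%:R^-1 * (\sum_k dot (x - q k) (x - q k)) - dot (x - q i) (x - q i)).
Proof.
have E k : dot (x - q k) (x - q k) = dot x x - 2 * dot x (q k) + dot (q k) (q k).
  by rewrite dotBl !dotBr (dotC (q k) x); ring.
rewrite (eq_bigr _ (fun k _ => E k)) E big_split /= sumrB sumr_const card_ord.
rewrite -(mulr_natl (dot x x)) -mulr_sumr /bary /centroid dotBr dotZr dot_sumr.
by field; rewrite d1_neq0 gt_eqF.
Qed.

Lemma bary_vertex i j : bary i (q j) = (i == j)%:R.
Proof.
rewrite baryE simplex_side; under eq_bigr do rewrite simplex_side.
rewrite -mulr_sumr (bigD1 j) //= eqxx /= (eq_bigr (fun=> 1)); last first.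
  by move=> k kj; rewrite eq_sym kj.
rewrite sumr_const cardC1 card_ord /= add0r eq_sym.
by case: eqP => _ /=; field; rewrite d1_neq0 gt_eqF.
Qed.

Lemma bary_sum x : \sum_i bary i x = 1.
Proof.
under eq_bigr do rewrite baryE.
rewrite big_split /= -mulr_sumr sumrB !sumr_const card_ord -[in X in X + _]mulr_natl.
rewrite -[X in _ * (X - _)]mulr_natl.
by field; rewrite d1_neq0 gt_eqF.
Qed.

Lemma label_sum (a : S) : \sum_j (val a j)%:R = l%:R - 1 :> R.
Proof.
rewrite -natr_sum (eqP (valP a)) -[in RHS](prednK (ltnW hl)) -natr1.
by rewrite addrK.
Qed.

Lemma l_neq0 : l%:R != 0 :> R.
Proof. by rewrite pnatr_eq0 -lt0n ltnW. Qed.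

(** [bary i] is affine, and [psi q a x] is the barycentre of [x] with weight [1 / l] and of the
    [q j] with weights [val a j / l]; the weights sum to 1 because [|a| = l - 1]. *)
Lemma bary_psi i (a : S) x : bary i (psi q a x) = (bary i x + (val a i)%:R) / l%:R.
Proof.
have -> : (val a i)%:R = \sum_j (val a j)%:R * bary i (q j) :> R.
  rewrite (bigD1 i) //= bary_vertex eqxx mulr1 big1 ?addr0// => j ji.
  by rewrite bary_vertex eq_sym (negbTE ji) mulr0.
rewrite /bary; set k := _ + s ^- 2 * _; set n := q i - _; set C := 2 * _.
under eq_bigr do rewrite mulrDr.
rewrite big_split /= -mulr_suml label_sum /psi dotZl dotDl dot_suml.
under [in RHS]eq_bigr do rewrite mulrCA.
rewrite -mulr_sumr; under [in LHS]eq_bigr do rewrite dotZl.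
by have := l_neq0 => l0; field.
Qed.

Lemma bary_continuous i : continuous (bary i).
Proof.
move=> x; rewrite /bary; apply: (@continuousD R R V); first exact: cst_continuous.
by apply: (@continuousM R V); [exact: cst_continuous|exact: dot_continuous].
Qed.

Arguments bary_continuous : clear implicits.

Lemma psi_continuous (a : S) : continuous (psi q a).
Proof.
move=> x; refine (@continuousZl_tmp R V V (fun y => y + \sum_j _ *: q j) _ x _).
by apply: (@continuousD R V V); [exact: cvg_id|exact: cst_continuous].
Qed.

Arguments psi_continuous : clear implicits.

Lemma psi_in (a : S) x : K x -> K (psi q a x).
Proof. by case: hK => _ _ eK Kx; rewrite eK; exists a => //; exists x. Qed.

Lemma psi_ex x : K x -> exists (a : S) y, K y /\ x = psi q a y.
Proof. by case: hK => _ _ eK; rewrite {1}eK => -[a _ [y Ky <-]]; exists a, y. Qed.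

(** At a minimum point [y = psi q a z] of [bary i] on [K], the value is [(bary i z + val a i) / l],
    hence at least [bary i y / l]; as [l > 1] it cannot be negative. *)
Lemma bary_ge0 i x : K x -> 0 <= bary i x.
Proof.
have [K0 cK _] := hK.
have [y yK ymin] := @compact_EVT_min _ R (bary i) K K0 cK
  (continuous_subspaceT (bary_continuous i)).
move=> Kx; apply: le_trans (ymin x _); last by rewrite inE.
move: yK; rewrite inE => /psi_ex[a [z [Kz yE]]].
have := ymin z; rewrite inE => /(_ Kz) yz.
have l0 : 0 < l%:R :> R by rewrite lt0r l_neq0 ler0n.
have : bary i y * l%:R >= bary i y.
  by rewrite [in leRHS]yE bary_psi divfK ?l_neq0// (le_trans yz)// lerDl ler0n.
have {yE} l1 : 1 < l%:R :> R by rewrite ltr1n.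
by nra.
Qed.

(** Each [psi q a] divides the defect [P] by [l]. At a point of [K] where [|P|] is maximal, written
    as [psi q a z], this gives [l * |P| <= |P|], so [P] vanishes on [K]. *)
Lemma bary_comb x : K x -> x = \sum_i bary i x *: q i.
Proof.
have [K0 cK _] := hK; pose P (x : V) : V := x - \sum_i bary i x *: q i.
have Pc : continuous (fun x => `|P x|).
  move=> y; apply: continuous_comp; last exact: norm_continuous.
  apply: (@continuousB R V V); first exact: cvg_id.
  move: y; apply: (continuous_big add_continuous) => i _ z.
  by apply: (@continuousZr_tmp R V V); exact: bary_continuous.
have [y yK ymax] := @compact_EVT_max _ R (fun x => `|P x|) K K0 cK
  (continuous_subspaceT Pc).
have Ppsi (a : S) z : P (psi q a z) = l%:R^-1 *: P z.
  rewrite /P [in RHS]scalerBr; under eq_bigr do rewrite bary_psi mulrC -scalerA scalerDl.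
  rewrite /psi scalerDr -[LHS]addrA; congr (_ + _).
  by rewrite -scaler_sumr big_split /= scalerDr opprD addrCA subrr addr0.
move=> Kx; apply/eqP; rewrite -subr_eq0 -/(P x) -normr_le0.
apply: le_trans (ymax x _) _; first by rewrite inE.
move: yK; rewrite inE => /psi_ex[a [z [Kz yE]]].
have := ymax z; rewrite inE => /(_ Kz) yz.
have l1 : 1 < l%:R :> R by rewrite ltr1n.
have : `|P y| * l%:R <= `|P y|.
  rewrite [in leLHS]yE Ppsi normrZ normfV normr_nat mulrAC mulVf ?l_neq0//.
  by rewrite mul1r.
by move: (normr_ge0 (P y)) => {yE}; nra.
Qed.

Lemma bary_eq1 i x : K x -> bary i x = 1 -> x = q i.
Proof.
move=> Kx xi1; have xj j : j != i -> bary j x = 0.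
  move=> ji; have := bary_sum x; rewrite (bigD1 i)//= xi1.
  move=> /(canRL (addKr _)); rewrite addNr => H.
  exact: (@psumr_eq0P _ _ _ _ (fun j _ => bary_ge0 j Kx) H j ji).
rewrite (bary_comb Kx) (bigD1 i)//= xi1 scale1r big1 ?addr0// => j /xj ->.
by rewrite scale0r.
Qed.

Lemma label_of (al : 'I_d.+1 -> nat) : (\sum_j al j = l.-1)%N ->
  exists a : S, forall j, val a j = al j :> nat.
Proof.
move=> al1; have H j : (al j < l)%N.
  by rewrite -(prednK (ltnW hl)) ltnS -al1 (bigD1 j)//= leq_addr.
have Ha : (\sum_j ([ffun j => Ordinal (H j)] j : nat) == l.-1)%N.
  by apply/eqP; rewrite -al1; apply: eq_bigr => j _; rewrite ffunE.
by exists (exist _ [ffun j => Ordinal (H j)] Ha) => j /=; rewrite ffunE.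
Qed.

Lemma label_eq (a b : S) : (forall j, val a j = val b j :> nat) -> a = b.
Proof. by move=> ab; apply/val_inj/ffunP => j; apply/val_inj; exact: ab. Qed.

Lemma vlabel_subproof i : exists a : S, forall j, val a j = ((j == i) * l.-1)%N :> nat.
Proof.
apply: label_of; rewrite (bigD1 i)//= eqxx mul1n big1 ?addn0// => j /negbTE ->.
by rewrite mul0n.
Qed.

Definition vlabel i : S := sval (cid (vlabel_subproof i)).

Lemma vlabelE i j : val (vlabel i) j = ((j == i) * l.-1)%N :> nat.
Proof. exact: (svalP (cid (vlabel_subproof i))). Qed.

Lemma psi_vertex i : psi q (vlabel i) (q i) = q i.
Proof.
rewrite /psi (bigD1 i)//= vlabelE eqxx mul1n big1 ?addr0; last first.
  by move=> j /negbTE ji; rewrite vlabelE ji mul0n scale0r.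
rewrite -[X in X + _]scale1r -scalerDl addrC natr1 prednK ?(ltnW hl)// scalerA.
by rewrite mulVf ?l_neq0// scale1r.
Qed.

(** If [bary i] is maximal at [y], comparison with the image of [y] in the cell [vlabel i] gives
    [(bary i y + l - 1) / l <= bary i y], so [bary i y = 1] and [y] is [q i]. *)
Lemma vertex_in i : K (q i).
Proof.
have [K0 cK _] := hK.
have [y yK ymax] := @compact_EVT_max _ R (bary i) K K0 cK
  (continuous_subspaceT (bary_continuous i)).
move: yK; rewrite inE => Ky.
have := ymax (psi q (vlabel i) y); rewrite inE => /(_ (psi_in _ Ky)).
rewrite bary_psi vlabelE eqxx mul1n => H.
have l1 : 1 < l%:R :> R by rewrite ltr1n.
have e : l.-1%:R = l%:R - 1 :> R.
  by rewrite -[in RHS](prednK (ltnW hl)) -natr1 addrK.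
have y1 : bary i y <= 1.
  rewrite -(bary_sum y) (bigD1 i)//= lerDl; apply: sumr_ge0 => j _.
  exact: bary_ge0.
move: H; rewrite ler_pdivrMr ?e; last lra.
move=> H; rewrite -(@bary_eq1 i y)//.
by apply/eqP; rewrite eq_le y1/=; nra.
Qed.

Lemma psi_inj (a : S) x y : psi q a x = psi q a y -> x = y.
Proof.
move=> /(scalerI _) H; have := H; rewrite invr_eq0 l_neq0 => /(_ isT).
exact: addIr.
Qed.

(* If [al i > be i], comparing the [i]-th barycentric coordinates of the two
   sides forces [bary i z >= 1], that is [z = q i]. *)
Lemma psi_overlap (a b : S) y z : a != b -> K y -> K z -> psi q a y = psi q b z ->
  exists i j, y = q i /\ z = q j.
Proof.
move=> ab Ky Kz yz.
have E k : bary k y + (val a k)%:R = bary k z + (val b k)%:R.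
  have := congr1 (bary k) yz; rewrite !bary_psi => /(mulIf _); apply.
  by rewrite invr_eq0 l_neq0.
have le1 k x : K x -> bary k x <= 1.
  move=> Kx; rewrite -(bary_sum x) (bigD1 k)//= lerDl; apply: sumr_ge0 => j _.
  exact: bary_ge0.
have gap (a' b' : S) : a' != b' -> exists k, (val b' k < val a' k)%N.
  move=> ab'; apply/not_existsP => nex; move/negP: ab'; apply; apply/eqP.
  have le k : (val a' k <= val b' k)%N by rewrite leqNgt; apply/negP/nex.
  apply: label_eq => j; apply/eqP; rewrite eqn_leq le/=.
  have : (\sum_k val a' k = \sum_k val b' k)%N.
    by rewrite (eqP (valP a')) (eqP (valP b')).
  rewrite (bigD1 j)//= [RHS](bigD1 j)//= => e.
  have : (\sum_(k < d.+1 | k != j) val a' k <= \sum_(k < d.+1 | k != j) val b' k)%N.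
    by apply: leq_sum => k _; exact: le.
  by rewrite -(leq_add2l (val a' j)) e leq_add2r.
have vert (a' b' : S) y' z' : (forall k, bary k y' + (val a' k)%:R = bary k z' + (val b' k)%:R) ->
   a' != b' -> K y' -> K z' -> exists i, z' = q i.
  move=> E' /gap[k]; rewrite -(ler_nat R) -natr1 => lt Ky' Kz'; exists k; apply: bary_eq1 => //.
  have := E' k; have := bary_ge0 k Ky'; have := le1 k _ Kz'.
  by move=> H1 H2 H3; apply/eqP; rewrite eq_le H1/=; lra.
have [j zj] := vert _ _ _ _ E ab Ky Kz.
have ba : b != a by rewrite eq_sym.
have [i yi] := vert _ _ _ _ (fun k => esym (E k)) ba Kz Ky.
by exists i, j.
Qed.

(** * Small cells, density of the vertices, and continuity on [K] *)

Lemma within_continuousP (A : set V) (f : V -> R) : {within A, continuous f} <->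
  forall x, A x -> forall e : R, 0 < e ->
    exists2 dl, 0 < dl & forall y, A y -> `|x - y| < dl -> `|f x - f y| < e.
Proof.
split=> [/subspace_continuousP H x Ax e e0|H].
  have /cvgrPdist_lt /(_ e e0) := H x Ax.
  rewrite near_withinE => /nbhs_ballP[dl dl0 Hb].
  exists dl => // y Ay xy; apply: Hb => //.
  by rewrite -ball_normE.
apply/subspace_continuousP => x Ax; apply/cvgrPdist_lt => e e0.
have [dl dl0 Hd] := H x Ax e e0; rewrite near_withinE; apply/nbhs_ballP; exists dl => //= y.
by rewrite -ball_normE /= => xy Ay; exact: Hd.
Qed.

Lemma psi_dist (a : S) x y : `|psi q a x - psi q a y| = l%:R^-1 * `|x - y|.
Proof.
rewrite /psi -scalerBr opprD addrACA subrr addr0 normrZ.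
by rewrite normfV normr_nat.
Qed.

Lemma psiw_dist (w : seq S) x y :
  `|psiw q w x - psiw q w y| = l%:R ^- size w * `|x - y|.
Proof.
elim: w => [|a w IH] /=; first by rewrite expr0 invr1 mul1r.
by rewrite psi_dist IH exprS invfM mulrA.
Qed.

Lemma psiw_continuous (w : seq S) : continuous (psiw q w).
Proof.
elim: w => [|a w IH] x; first exact: cvg_id.
exact: (@continuous_comp _ _ _ (psiw q w) (psi q a) x (IH x) (psi_continuous a _)).
Qed.

Lemma psiw_in (w : seq S) x : K x -> K (psiw q w x).
Proof. by elim: w => //= a w IH /IH; exact: psi_in. Qed.

Lemma psiw_ex m x : K x -> exists (w : m.-tuple S) y, K y /\ x = psiw q w y.
Proof.
elim: m x => [|m IH] x Kx; first by exists [tuple], x.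
have [a [y [/IH[w [z [Kz ->]]] ->]]] := psi_ex Kx.
by exists [tuple of a :: w], z.
Qed.

Lemma cells_small (e : R) : 0 < e -> exists m0, forall m, (m0 <= m)%N ->
  forall w : m.-tuple S, forall x y, K x -> K y -> `|psiw q w x - psiw q w y| < e.
Proof.
move=> e0; have [_ /compact_bounded [M [_ KM]] _] := hK.
have {KM} /= KM := KM (`|M| + 1); have : M < `|M| + 1 by rewrite ltr_pwDr ?ler_norm.
move=> /KM {}KM; set N : R := `|M| + 1 in KM.
have N0 : 0 < N by rewrite ltr_wpDl.
(* [N] bounds the norm on [K], so a cell of level [m] has diameter at most [2 * N / l ^ m]; since
   [l >= 2], [l ^ m] exceeds [m]. *)
exists (Num.trunc (2 * N / e)).+1 => m m0m w x y /KM xM /KM yM.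
rewrite psiw_dist size_tuple mulrC ltr_pdivrMr ?exprn_gt0 ?ltr0n ?(ltnW hl)//.
apply: (@le_lt_trans _ _ (2 * N)).
  by rewrite (le_trans (ler_normB _ _))// mulr_natl mulr2n lerD.
rewrite [ltRHS]mulrC -ltr_pdivrMr// (lt_le_trans (truncnS_gt _))// -natrX ler_nat.
by rewrite (leq_trans m0m)// ltnW// ltn_expl.
Qed.

Lemma vertices_dense x (e : R) : K x -> 0 < e -> exists w : seq S, `|x - psiw q w (q ord0)| < e.
Proof.
move=> Kx /cells_small[m /(_ m (leqnn m)) H].
have [w [y [Ky ->]]] := psiw_ex m Kx.
by exists w; apply: H => //; exact: vertex_in.
Qed.

Lemma eq_on_vertices (f g : V -> R) :
  {within K, continuous f} -> {within K, continuous g} ->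
  (forall w : seq S, f (psiw q w (q ord0)) = g (psiw q w (q ord0))) ->
  forall x, K x -> f x = g x.
Proof.
move=> /within_continuousP fc /within_continuousP gc fg x Kx.
apply/eqP; rewrite -subr_eq0 -normr_le0; apply/ler_addgt0Pl => e e0; rewrite addr0.
have e20 : 0 < e / 2 by rewrite divr_gt0.
have [d1 d10 H1] := fc x Kx _ e20; have [d2 d20 H2] := gc x Kx _ e20.
have [|w] := @vertices_dense x (Num.min d1 d2) Kx; first by rewrite lt_min d10.
rewrite lt_min => /andP[w1 w2].
have Kw : K (psiw q w (q ord0)) by apply/psiw_in/vertex_in.
have := H1 _ Kw w1; have := H2 _ Kw w2; rewrite fg.
set t := g (psiw _ _ _) => gt ft.
rewrite -[f x](subrK t) -addrA (le_trans (ler_normD _ _))//.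
by rewrite [e]splitr lerD// ltW// distrC.
Qed.

Lemma K_closed x : (forall e : R, 0 < e -> exists2 y, K y & `|x - y| < e) -> K x.
Proof.
move=> H; have [_ cK _] := hK.
apply: (compact_closed (@norm_hausdorff _ _) cK) => B /nbhs_ballP[e e0 xB].
have [y Ky xy] := H e e0; exists y; split=> //; apply: xB.
by rewrite -ball_normE.
Qed.

(** The orthogonal reflection exchanging [q i] and [q j] (the identity if [i = j]): as
    [|q i - q j| = s], the coefficient is [2 <x - p, q i - q j> / s ^ 2] with [p] their midpoint.
    Through barycentric coordinates it visibly permutes vertices and cells. *)
Definition refl (i j : 'I_d.+1) (x : V) : V :=
  x - (bary i x - bary j x) *: (q i - q j).

Lemma bary_sub k x t y z :
  bary k (x - t *: (y - z)) = bary k x - t * (bary k y - bary k z).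
Proof. by rewrite /bary dotBl dotZl dotBl; ring. Qed.

Lemma refl_vertex i j k : refl i j (q k) = q (tperm i j k).
Proof.
rewrite /refl !bary_vertex; case: tpermP => [->|->|/eqP/negbTE ki /eqP/negbTE kj].
- rewrite eqxx; case: eqVneq => [->|ij]; first by rewrite !subrr scale0r subr0.
  by rewrite subr0 scale1r opprB addrC subrK.
- rewrite eqxx; case: eqVneq => [->|ij]; first by rewrite !subrr scale0r subr0.
  by rewrite sub0r scaleN1r opprK addrC subrK.
- by rewrite ![_ == k]eq_sym ki kj subrr scale0r subr0.
Qed.

Lemma reflK i j : involutive (refl i j).
Proof.
move=> x; rewrite {1}/refl !bary_sub !bary_vertex !eqxx.
case: (eqVneq i j) => [->|ij]; first by rewrite !subrr !scaler0 !subr0 /refl subrr scale0r subr0.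
rewrite /refl -addrA -opprD -scalerDl.
rewrite (_ : bary i x - bary j x + _ = 0) ?scale0r ?subr0//.
by rewrite /=; ring.
Qed.

Lemma refl_edist i j x y : Defs.edist (refl i j x) (refl i j y) = Defs.edist x y.
Proof.
rewrite !edist_dot; congr Num.sqrt; set v := x - y.
have -> : refl i j x - refl i j y = v - (2 * s ^- 2 * dot v (q i - q j)) *: (q i - q j).
  rewrite /refl (opprD y) addrACA opprK -!(scaleNr _ (q i - q j)) -scalerDl; congr (_ + _ *: _).
  by rewrite /bary /v !dotBr !dotBl; ring.
case: (eqVneq i j) => [->|ij]; first by rewrite subrr scaler0 subr0.
have nn := simplex_side i j; rewrite ij mulr1 in nn.
clearbody v; move: (q i - q j) nn => n nn.
rewrite dotBl !dotBr !dotZl !dotZr nn (dotC n v).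
by field; rewrite gt_eqF.
Qed.

Lemma tlabel_subproof (i j : 'I_d.+1) (a : S) :
  exists b : S, forall k, val b k = val a (tperm i j k) :> nat.
Proof.
apply: label_of; rewrite (reindex_inj (@perm_inj _ (tperm i j)))/=.
by under eq_bigr do rewrite tpermK; exact: (eqP (valP a)).
Qed.

Definition tlabel i j (a : S) : S := sval (cid (tlabel_subproof i j a)).

Lemma tlabelE i j a k : val (tlabel i j a) k = val a (tperm i j k) :> nat.
Proof. exact: (svalP (cid (tlabel_subproof i j a))). Qed.

Lemma tlabelK i j : involutive (tlabel i j).
Proof. by move=> a; apply: label_eq => k; rewrite !tlabelE tpermK. Qed.

Lemma refl_psi i j (a : S) x : refl i j (psi q a x) = psi q (tlabel i j a) (refl i j x).
Proof.
have tE : \sum_k (val (tlabel i j a) k)%:R *: q k =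
    \sum_k (val a k)%:R *: q k - ((val a i)%:R - (val a j)%:R) *: (q i - q j).
  rewrite (reindex_inj (@perm_inj _ (tperm i j)))/=.
  under eq_bigr do rewrite tlabelE tpermK -refl_vertex /refl !bary_vertex scalerBr.
  rewrite sumrB; congr (_ - _).
  under eq_bigr do rewrite scalerA.
  rewrite -scaler_suml; congr (_ *: _).
  under eq_bigr do rewrite mulrBr.
  by rewrite sumrB; congr (_ - _); under eq_bigr do rewrite eq_sym mulr_natr mulrb;
    rewrite -big_mkcond big_pred1_eq.
rewrite {2}/psi tE {2}/refl addrACA -opprD -scalerDl scalerBr scalerA.
rewrite /refl !bary_psi; congr (_ - _ *: _).
by ring.
Qed.

Lemma refl_psiw i j (w : seq S) x :
  refl i j (psiw q w x) = psiw q (map (tlabel i j) w) (refl i j x).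
Proof. by elim: w => //= a w IH; rewrite refl_psi IH. Qed.

Lemma refl_continuous i j : continuous (refl i j).
Proof.
move=> x; apply: (@continuousB R V V (fun x => x)
  (fun x => (bary i x - bary j x) *: (q i - q j))); first exact: cvg_id.
apply: (@continuousZr_tmp R V V).
by apply: (@continuousB R R V); exact: bary_continuous.
Qed.

(** The reflection maps the points [psiw q w (q k)] of [K] to points of the same kind; these are
    dense in [K], and [K] is closed. *)
Lemma refl_in i j x : K x -> K (refl i j x).
Proof.
move=> Kx; apply: K_closed => e e0.
have /cvgrPdist_lt /(_ e e0) /nbhs_ballP [dl dl0 H] := @refl_continuous i j x.
have [w xw] := vertices_dense Kx dl0.
exists (refl i j (psiw q w (q ord0))).
  by rewrite refl_psiw refl_vertex; exact/psiw_in/vertex_in.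
by apply: H; rewrite -ball_normE.
Qed.

Lemma refl_cell i j (a : S) :
  refl i j @` (psi q a @` K) = psi q (tlabel i j a) @` K.
Proof.
apply/seteqP; split=> [_ [_ [x Kx <-] <-]|_ [x Kx <-]].
  by rewrite refl_psi; exists (refl i j x) => //; exact: refl_in.
exists (psi q a (refl i j x)); last by rewrite refl_psi reflK.
by exists (refl i j x) => //; exact: refl_in.
Qed.

Lemma refl_symmetry i j : simplex_symmetry q (refl i j).
Proof.
split; first exact: refl_edist.
apply/seteqP; split=> [_ [_ [k _ <-] <-]|_ [k _ <-]].
  by exists (tperm i j k) => //; rewrite refl_vertex.
exists (q (tperm i j k)); last by rewrite refl_vertex tpermK.
by exists (tperm i j k).
Qed.

(** * Gluing functions cell by cell, and adjacency of cells *)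

Lemma psi_surj (a : S) x : exists y, x = psi q a y.
Proof.
exists (l%:R *: x - \sum_j (val a j)%:R *: q j).
by rewrite /psi subrK scalerA mulVf ?l_neq0// scale1r.
Qed.

(** Distinct cells meet only at images of vertices, by [psi_overlap], so agreement at these points
    is the whole compatibility condition. *)
Lemma glue (G : S -> V -> R) :
  (forall a b i j, psi q a (q i) = psi q b (q j) -> G a (q i) = G b (q j)) ->
  exists g : V -> R, forall a x, K x -> g (psi q a x) = G a x.
Proof.
move=> H.
exists (fun y => xget 0 [set v | exists a x, [/\ K x, y = psi q a x & v = G a x]]).
move=> a x Kx; case: xgetP => [v _ [b [z [Kz xz ->]]]|/(_ (G a x))[]]; last by exists a, x.
have [eab|ab] := eqVneq a b; first by move: xz; rewrite eab => /psi_inj ->.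
have [i [j [xi zj]]] := psi_overlap ab Kx Kz xz.
by rewrite xi zj; apply/esym/H; rewrite -xi -zj.
Qed.

Lemma glue_continuous (g : V -> R) :
  (forall a : S, {within K, continuous (g \o psi q a)}) -> {within K, continuous g}.
Proof.
move=> H; apply/subspace_continuousP => x Kx; apply/cvgrPdist_lt => e e0.
rewrite near_withinE.
have : \forall y \near x, forall a : S, forall z, K z -> y = psi q a z -> `|g x - g y| < e.
  apply: (@filter_forall _ _ _ (nbhs x) _) => a; apply/nbhs_ballP.
  have l0 : 0 < l%:R :> R by rewrite ltr0n ltnW.
  have [z xz] := psi_surj a x.
  have [Kz|nKz] := pselect (K z).
    have /within_continuousP/(_ z Kz e e0)[dl dl0 Hd] := H a.
    exists (l%:R^-1 * dl); first by rewrite /= mulr_gt0 ?invr_gt0.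
    move=> y; rewrite -ball_normE /= => xy t Kt yt; rewrite xz yt; apply: Hd => //.
    by move: xy; rewrite xz yt psi_dist ltr_pM2l// invr_gt0.
  (* When [x] is outside the cell of [a], closedness of [K] keeps that cell at a positive distance
     from [x], and the condition is vacuous near [x]. *)
  have [dl dl0 Hd] : exists2 dl : R, 0 < dl & forall y, K y -> dl <= `|z - y|.
    apply: contrapT => nex; apply: nKz; apply: K_closed => dl dl0.
    apply: contrapT => ney; apply: nex; exists dl => // y Ky.
    by rewrite leNgt; apply/negP => zy; apply: ney; exists y.
  exists (l%:R^-1 * dl); first by rewrite /= mulr_gt0 ?invr_gt0.
  move=> y; rewrite -ball_normE /= => + t Kt yt.
  by rewrite xz yt psi_dist ltr_pM2l ?invr_gt0// ltNge Hd.
apply: filterS => y Hy /psi_ex[a [z [Kz yz]]].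
exact: Hy yz.
Qed.

Lemma psi_move (a b : S) i j :
  (forall k, val a k + (k == i) = val b k + (k == j))%N -> psi q a (q i) = psi q b (q j).
Proof.
have E (a' : S) i' : psi q a' (q i') = l%:R^-1 *: \sum_k (val a' k + (k == i'))%:R *: q k.
  rewrite /psi addrC; congr (_ *: _).
  under [in RHS]eq_bigr do rewrite natrD scalerDl.
  rewrite big_split /=; congr (_ + _).
  rewrite (bigD1 i')//= eqxx scale1r big1 ?addr0// => k /negbTE ->.
  by rewrite scale0r.
by move=> H; rewrite !E; under eq_bigr do rewrite H.
Qed.

Lemma sum_delta (i : 'I_d.+1) : (\sum_(k < d.+1) (k == i))%N = 1%N.
Proof. by rewrite (bigD1 i)//= eqxx big1// => k /negbTE ->. Qed.

(** Moving one unit of the multi-index from an entry [j] to the entry [o] leads to an adjacent cell,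
    which shares a vertex by [psi_move]; repeating this ends at the cell [vlabel o]. *)
Lemma vertices_connected (g : V -> R) :
  (forall (a : S) i j, g (psi q a (q i)) = g (psi q a (q j))) ->
  forall (a b : S) i j, g (psi q a (q i)) = g (psi q b (q j)).
Proof.
move=> H; pose o : 'I_d.+1 := ord0.
suff C (a : S) : g (psi q a (q o)) = g (psi q (vlabel o) (q o)).
  by move=> a b i j; rewrite (H a i o) (H b j o) !C.
have [n] := ubnP (l.-1 - val a o)%N; elim: n a => // n IH a an.
have aS : (\sum_j val a j = l.-1)%N := eqP (valP a).
have [/existsP[j /andP[jo aj]]|/existsPn nex] := boolP [exists j, (j != o) && (0 < val a j)%N].
  have [|b bE] := @label_of (fun k => val a k - (k == j) + (k == o))%N.
    rewrite big_split /= sum_delta -(sum_delta j) -big_split -[RHS]aS.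
    by apply: eq_bigr => k _ /=; case: eqVneq => [->|_]; rewrite subnK.
  rewrite (@psi_move a b o j) ?(H b j o).
    apply: IH; rewrite bE eqxx eq_sym (negbTE jo) subn0.
    have : (val a o < l.-1)%N.
      by move: aS aj; rewrite (bigD1 o)//= (bigD1 j)//=; lia.
    by move: an; lia.
  move=> k; rewrite bE addnAC; case: (eqVneq k j) => [->|]; last by rewrite subn0 addn0.
  by rewrite subnK.
have a0 k : k != o -> val a k = 0%N :> nat.
  by move=> ko; have := nex k; rewrite ko /= -leqNgt leqn0 => /eqP.
congr (g (psi q _ _)); apply: label_eq => j; rewrite vlabelE.
have [->|jo] := eqVneq j o; last by rewrite a0.
by rewrite mul1n -[RHS]aS (bigD1 o)//= big1 ?addn0.
Qed.

(* The cells [(l - 1 - t) e_i + t e_j] form a chain along the edge from [q i] to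
   [q j]; consecutive ones meet at a point which is not a vertex of the simplex. *)
Lemma edge_path (P : V -> Prop) i j : i != j ->
  P (psi q (vlabel i) (q j)) ->
  (forall (a : S) m n, (forall k, psi q a (q m) != q k) ->
     P (psi q a (q m)) -> P (psi q a (q n))) ->
  P (q j).
Proof.
move=> ij P0 prop.
have chain t : (t <= l.-1)%N -> exists b : S,
    forall k, val b k = ((k == i) * (l.-1 - t) + (k == j) * t)%N :> nat.
  move=> tl; apply: label_of.
  by rewrite big_split /= -!big_distrl /= !sum_delta !mul1n subnK.
suff C t : (t <= l.-1)%N -> forall b : S,
    (forall k, val b k = ((k == i) * (l.-1 - t) + (k == j) * t)%N :> nat) ->
    P (psi q b (q j)).
  rewrite -(psi_vertex j); apply: (C l.-1) => // k.
  by rewrite vlabelE subnn muln0.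
elim: t => [|t IH] tl b bE.
  by rewrite (_ : b = vlabel i)//; apply: label_eq => k; rewrite bE vlabelE muln0 addn0 subn0.
have [b' b'E] := chain t (ltnW tl).
have mv : psi q b' (q j) = psi q b (q i).
  apply: psi_move => k; rewrite bE b'E.
  by have [ki|ki] := eqVneq k i; have [kj|kj] := eqVneq k j => //=; lia.
apply: (prop b i j); last by rewrite -mv; apply: IH => //; exact: ltnW.
move=> k; apply/eqP => /(congr1 (bary i)); rewrite -mv bary_psi !bary_vertex b'E.
rewrite eqxx (negbTE ij) mul1n addn0 add0r.
move=> /(canRL (divfK l_neq0))/eqP; rewrite -natrM eqr_nat => /eqP.
by case: (i == k); lia.
Qed.

(** * The Dirichlet form *)

Context (hr : canonical_harmonic_structure q K c r).

Lemma c_gt0 : 0 < c. Proof. by case: hr. Qed.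

Lemma r_gt0 a : 0 < r a. Proof. by case: hr => _ /(_ a)/andP[]. Qed.

Lemma r_lt1 a : r a < 1. Proof. by case: hr => _ /(_ a)/andP[]. Qed.

Lemma r_inv_gt0 a : 0 < (r a)^-1. Proof. by rewrite invr_gt0 r_gt0. Qed.

Lemma r_tlabel i j a : r (tlabel i j a) = r a.
Proof.
case: hr => _ _ H _; symmetry; apply: H (refl_symmetry i j) _.
exact: refl_cell.
Qed.

Lemma weight_gt0 w : 0 < weight r w.
Proof.
by rewrite /weight big_seq; apply: prodr_gt0 => a _; exact: r_gt0.
Qed.

Lemma weight_le1 w : weight r w <= 1.
Proof. by rewrite /weight; apply: prodr_ile1 => a _; rewrite !ltW ?r_gt0 ?r_lt1. Qed.

Lemma energyn_ge0 m f : 0 <= En m f f.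
Proof.
apply: sumr_ge0 => w _; rewrite mulr_ge0 ?energy0_ge0 ?ltW ?c_gt0//.
by rewrite invr_gt0 weight_gt0.
Qed.

(** Half of the renormalization identity: [f] itself competes in the infimum. By self-similarity the
    energies then increase with the level. *)
Lemma energyn_le1 f : En 0 f f <= En 1 f f.
Proof.
rewrite energyn0; case: hr => _ _ _ ->; apply: ge_inf; last by exists f.
by exists 0 => _ [g _ <-]; exact: energyn_ge0.
Qed.

Lemma energyn_leS m f : En m f f <= En m.+1 f f.
Proof.
elim: m f => [|m IH] f; first exact: energyn_le1.
rewrite energynS [leRHS]energynS; apply: ler_sum => a _.
by rewrite ler_pM2l ?r_inv_gt0.
Qed.

Lemma energyn_homo f : {homo (fun m => En m f f) : m n / (m <= n)%N >-> m <= n}.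
Proof. by apply/nondecreasing_seqP => m; exact: energyn_leS. Qed.

Lemma eq_energyn m f f' g g' : (forall x, K x -> f x = f' x) ->
  (forall x, K x -> g x = g' x) -> En m f g = En m f' g'.
Proof.
move=> ff gg; apply: eq_bigr => w _; congr (_ * _).
by congr energy0; apply/funext => i; [apply: ff|apply: gg]; exact/psiw_in/vertex_in.
Qed.

Lemma energyn_refl m i j f g : En m (f \o refl i j) (g \o refl i j) = En m f g.
Proof.
elim: m f g => [|m IH] f g.
  rewrite !energyn0 !energy0_sumsq; congr (_ * _).
  rewrite [RHS](reindex_inj (@perm_inj _ (tperm i j)))/=; apply: eq_bigr => k _.
  rewrite [RHS](reindex_inj (@perm_inj _ (tperm i j)))/=; apply: eq_bigr => k' _.
  by rewrite !refl_vertex.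
rewrite !energynS (reindex_inj (inv_inj (@tlabelK i j)))/=; apply: eq_bigr => a _.
rewrite r_tlabel -[in RHS]IH; congr (_ * En _ _ _);
  by apply/funext => x /=; rewrite refl_psi tlabelK.
Qed.

(** A common source for the stability of the domain under sums, products and contractions: [E0] is a
    positive combination of squared increments, so a pointwise bound on increments holds for the
    energy at every level with the same constants. *)
Lemma energyn_contract m C1 C2 phi f g :
  (forall x y, K x -> K y ->
     (phi x - phi y) ^+ 2 <= C1 * (f x - f y) ^+ 2 + C2 * (g x - g y) ^+ 2) ->
  En m phi phi <= C1 * En m f f + C2 * En m g g.
Proof.
move=> H; rewrite !mulr_sumr -big_split; apply: ler_sum => w _ /=.
rewrite (mulrCA C1) (mulrCA C2) -mulrDr ler_pM2l ?invr_gt0 ?weight_gt0//.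
rewrite !energy0_sumsq (mulrCA C1) (mulrCA C2) -mulrDr ler_pM2l ?divr_gt0 ?c_gt0//.
rewrite !mulr_sumr -big_split; apply: ler_sum => i _ /=.
rewrite !mulr_sumr -big_split; apply: ler_sum => j _ /=.
by rewrite -!expr2; apply: H; exact/psiw_in/vertex_in.
Qed.

Lemma domFP f : F f <->
  {within K, continuous f} /\ exists C, forall m, En m f f <= C.
Proof.
split=> -[fc H]; split => //.
  by exists (E f f) => m; exact: nondecreasing_cvgn_le (@energyn_homo f) H m.
apply: nondecreasing_is_cvgn; first exact: energyn_homo.
by case: H => C HC; exists C => _ [m _ <-]; exact: HC.
Qed.

Lemma energyn_le_energy f m : F f -> En m f f <= E f f.
Proof. by case=> _ H; exact: nondecreasing_cvgn_le (@energyn_homo f) H m. Qed.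

Lemma energy_le f C : F f -> (forall m, En m f f <= C) -> E f f <= C.
Proof. by case=> _ H HC; apply: limr_le => //; near=> m; exact: HC. Unshelve. all: by end_near. Qed.

Lemma energy_ge0 f : F f -> 0 <= E f f.
Proof. by move=> Ff; apply: le_trans (energyn_le_energy 0 Ff); exact: energyn_ge0. Qed.

Lemma continuous_withinD t (f g : V -> R) : {within K, continuous f} ->
  {within K, continuous g} -> {within K, continuous (fun x => f x + t * g x)}.
Proof.
move=> /subspace_continuousP fc /subspace_continuousP gc.
apply/subspace_continuousP => x Kx; apply: cvgD; first exact: fc.
by apply: cvgM; [exact: cvg_cst|exact: gc].
Qed.

Lemma domFD t f g : F f -> F g -> F (fun x => f x + t * g x).
Proof.
move=> /domFP[fc [C HC]] /domFP[gc [D HD]]; apply/domFP; split.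
  exact: continuous_withinD.
exists (2 * C + 2 * t ^+ 2 * D) => m.
apply: le_trans (_ : 2 * En m f f + 2 * t ^+ 2 * En m g g <= _).
  apply: energyn_contract => x y _ _.
  set u := f x - f y; set v := g x - g y.
  rewrite (_ : _ - _ = u + t * v); last by rewrite /u /v; ring.
  by have := sqr_ge0 (u - t * v); nra.
by rewrite lerD// ler_wpM2l// mulr_ge0// sqr_ge0.
Qed.

Lemma domF_const b : F (fun=> b).
Proof.
apply/domFP; split; last by exists 0 => m; rewrite energyn_const.
by apply/within_continuousP => x _ e e0; exists 1 => // y _ _; rewrite subrr normr0.
Qed.

Lemma cvg_energy f g : F f -> F g -> En m f g @[m --> \oo] --> E f g.
Proof.
move=> Ff Fg; have [_ Hf] := Ff; have [_ Hg] := Fg.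
have [_ Hfg] := domFD 1 Ff Fg.
suff : cvgn (fun m => En m f g) by [].
have -> : (fun m => En m f g) = (fun m => 2^-1 *
    (En m (fun x => f x + 1 * g x) (fun x => f x + 1 * g x)
    - En m f f - En m g g)).
  apply/funext => m; rewrite energynDl !energynDr (energynC m g f).
  by field.
by apply: is_cvgMr; apply: is_cvgB => //; apply: is_cvgB.
Qed.

Lemma energyC f g : E f g = E g f.
Proof. by rewrite /energy; congr (limn _); apply/funext => m; rewrite energynC. Qed.

Lemma energyDl t f f' g : F f -> F f' -> F g ->
  E (fun x => f x + t * f' x) g = E f g + t * E f' g.
Proof.
move=> Ff Ff' Fg; apply: cvg_lim => //.
rewrite (_ : (fun m => _) = (fun m => En m f g + t * En m f' g)); last first.
  by apply/funext => m; rewrite energynDl.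
by apply: cvgD; [exact: cvg_energy|apply: cvgM; [exact: cvg_cst|exact: cvg_energy]].
Qed.

Lemma energyDr t f f' g : F f -> F f' -> F g ->
  E g (fun x => f x + t * f' x) = E g f + t * E g f'.
Proof. by move=> *; rewrite !(energyC g) energyDl. Qed.

Lemma energy_constl b g : E (fun=> b) g = 0.
Proof.
rewrite /energy (_ : (fun m => _) = fun=> 0) ?lim_cst//.
by apply/funext => m; rewrite energyn_const.
Qed.

Lemma eq_energy f f' g g' : (forall x, K x -> f x = f' x) ->
  (forall x, K x -> g x = g' x) -> E f g = E f' g'.
Proof. by move=> ff gg; congr (limn _); apply/funext => m; exact: eq_energyn. Qed.

Lemma eq_continuous_within (f g : V -> R) : (forall x, K x -> f x = g x) ->
  {within K, continuous f} -> {within K, continuous g}.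
Proof.
move=> fg /within_continuousP fc; apply/within_continuousP => x Kx e e0.
by have [dl dl0 H] := fc x Kx e e0; exists dl => // y Ky; rewrite -!fg//; exact: H.
Qed.

Lemma eq_domF f g : (forall x, K x -> f x = g x) -> F f -> F g.
Proof.
move=> fg /domFP[fc [C HC]]; apply/domFP; split; first exact: eq_continuous_within fc.
by exists C => m; rewrite -(eq_energyn m fg fg).
Qed.

Lemma domF_contract f phi : F f ->
  (forall x y, K x -> K y -> `|phi x - phi y| <= `|f x - f y|) ->
  F phi /\ E phi phi <= E f f.
Proof.
move=> Ff H; have [/within_continuousP fc _] := Ff.
have En_le m : En m phi phi <= En m f f.
  rewrite -[leRHS]addr0 -(mul1r (En m f f)) -(mul0r (En m f f)).
  apply: energyn_contract => x y Kx Ky; rewrite mul1r mul0r addr0.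
  by rewrite -ler_sqrt ?sqr_ge0// !sqrtr_sqr; exact: H.
have Fphi : F phi.
  apply/domFP; split; last first.
    by exists (E f f) => m; apply: le_trans (En_le m) _; exact: energyn_le_energy.
  apply/within_continuousP => x Kx e e0; have [dl dl0 Hd] := fc x Kx e e0.
  by exists dl => // y Ky xy; apply: le_lt_trans (H x y Kx Ky) _; exact: Hd.
split=> //; apply: energy_le => // m.
by apply: le_trans (En_le m) _; exact: energyn_le_energy.
Qed.

Lemma domF_bounded f : F f -> exists M : R, forall x, K x -> `|f x| <= M.
Proof.
case=> fc _; have [K0 cK _] := hK.
have nc : {within K, continuous (fun x => `|f x|)}.
  move=> x; apply: continuous_comp; [exact: fc|exact: norm_continuous].
have [y _ H] := @compact_EVT_max _ R (fun x => `|f x|) K K0 cK nc.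
by exists `|f y| => x Kx; apply: H; rewrite inE.
Qed.

Lemma domFM f g : F f -> F g -> F (f \* g).
Proof.
move=> Ff Fg; have [M HM] := domF_bounded Ff; have [N HN] := domF_bounded Fg.
apply/domFP; split.
  case: Ff Fg => /subspace_continuousP fc _ [/subspace_continuousP gc _].
  by apply/subspace_continuousP => x Kx; apply: cvgM; [exact: fc|exact: gc].
exists (2 * N ^+ 2 * E f f + 2 * M ^+ 2 * E g g) => m.
apply: le_trans (_ : 2 * N ^+ 2 * En m f f + 2 * M ^+ 2 * En m g g <= _); last first.
  by rewrite lerD// ler_wpM2l ?energyn_le_energy// mulr_ge0// sqr_ge0.
apply: energyn_contract => x y Kx Ky /=.
have sqr_le (a b : R) : `|a| <= b -> a ^+ 2 <= b ^+ 2.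
  by move=> ab; rewrite -real_normK ?num_real// lerXn2r ?nnegrE ?(le_trans _ ab).
have Mx := sqr_le _ _ (HM x Kx); have Ny := sqr_le _ _ (HN y Ky).
apply: le_trans (_ : 2 * (g y ^+ 2 * (f x - f y) ^+ 2) + 2 * (f x ^+ 2 * (g x - g y) ^+ 2) <= _).
  set u := f x - f y; set v := g x - g y.
  rewrite (_ : _ - _ = g y * u + f x * v); last by rewrite /u /v; ring.
  by have := sqr_ge0 (g y * u - f x * v); nra.
by apply: lerD; rewrite -[leRHS]mulrA; apply: ler_wpM2l => //;
  apply: ler_wpM2r => //; exact: sqr_ge0.
Qed.

Lemma domF_psi (a : S) f : F f -> F (f \o psi q a).
Proof.
move=> Ff; have [/within_continuousP fc _] := Ff.
apply/domFP; split.
  apply/within_continuousP => x Kx e e0.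
  have [dl dl0 H] := fc _ (psi_in a Kx) e e0.
  have l0 : 0 < l%:R :> R by rewrite ltr0n ltnW.
  exists (l%:R * dl); first by rewrite mulr_gt0.
  move=> y Ky xy; apply: H; first exact: psi_in.
  by rewrite psi_dist mulrC ltr_pdivrMr// mulrC.
exists (r a * E f f) => m; rewrite mulrC -ler_pdivrMr ?r_gt0// mulrC.
apply: le_trans (energyn_le_energy m.+1 Ff); rewrite energynS (bigD1 a)//= lerDl.
by apply: sumr_ge0 => b _; rewrite mulr_ge0 ?energyn_ge0// ltW ?r_inv_gt0.
Qed.

Lemma energy_psi f g : F f -> F g ->
  E f g = \sum_a (r a)^-1 * E (f \o psi q a) (g \o psi q a).
Proof.
move=> Ff Fg; apply: cvg_lim => //; rewrite -cvg_shiftS.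
rewrite (_ : (fun m => _) = fun m => \sum_a (r a)^-1 * En m (f \o psi q a) (g \o psi q a)).
  apply: (cvg_big add_continuous) => a _.
  by apply: cvgM; [exact: cvg_cst|apply: cvg_energy; exact: domF_psi].
by apply/funext => m; rewrite energynS.
Qed.

Lemma domF_glue f : (forall a : S, F (f \o psi q a)) -> F f.
Proof.
move=> H; apply/domFP; split; first by apply: glue_continuous => a; case: (H a).
exists (\sum_a (r a)^-1 * E (f \o psi q a) (f \o psi q a)) => m.
apply: le_trans (energyn_leS _ _) _; rewrite energynS; apply: ler_sum => a _.
by rewrite ler_pM2l ?r_inv_gt0//; exact: energyn_le_energy.
Qed.

(** Vanishing energy at all levels is inherited by every cell and forces equal values at the
    vertices of each cell; adjacency of the cells turns these into one constant. *)
Lemma energyn_eq0_const (w : seq S) f i : (forall m, En m f f = 0) ->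
  f (psiw q w (q i)) = f (q ord0).
Proof.
have zero f' (a : S) : (forall m, En m f' f' = 0) ->
    forall m, En m (f' \o psi q a) (f' \o psi q a) = 0.
  move=> H m; have := H m.+1; rewrite energynS => H'.
  have := @psumr_eq0P _ _ _ _ _ H' a isT => /(_ _)/eqP.
  rewrite mulf_eq0 gt_eqF ?r_inv_gt0//= => H2; apply/eqP/H2 => b _.
  by rewrite mulr_ge0 ?energyn_ge0// ltW ?r_inv_gt0.
have const0 f' j k : (forall m, En m f' f' = 0) -> f' (q j) = f' (q k).
  by move=> /(_ 0%N); rewrite energyn0 => /(energy0_eq0 c_gt0)/(_ j k).
elim: w f i => [|a w IH] f i H; first exact: const0.
have /= -> := IH _ i (zero f a H); rewrite -[in RHS](psi_vertex ord0).
apply: vertices_connected => b j k.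
exact: (const0 (f \o psi q b) j k (zero f b H)).
Qed.

Lemma energy_eq0 f x : F f -> E f f = 0 -> K x -> f x = f (q ord0).
Proof.
move=> Ff f0 Kx; apply: (eq_on_vertices _ _ _ Kx); first by case: Ff.
  by case: (domF_const (f (q ord0))).
move=> w; apply: energyn_eq0_const => m.
by apply/eqP; rewrite eq_le energyn_ge0 andbT -f0 energyn_le_energy.
Qed.

Lemma domF_psiw (w : seq S) f : F f -> F (f \o psiw q w).
Proof. by elim: w f => [|a w IH] f Ff //=; exact: IH _ (domF_psi a Ff). Qed.

Lemma energy_psiw m f g : F f -> F g -> E f g =
  \sum_(w : m.-tuple S) (weight r w)^-1 * E (f \o psiw q w) (g \o psiw q w).
Proof.
pose G f g w := (weight r w)^-1 * E (f \o psiw q w) (g \o psiw q w).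
elim: m f g => [|m IH] f g Ff Fg.
  by rewrite (sum_tuple0 (G f g)) /G /weight big_nil invr1 mul1r.
rewrite energy_psi// (sum_tupleS m (G f g)); apply: eq_bigr => a _.
rewrite (IH _ _ (domF_psi a Ff) (domF_psi a Fg)) mulr_sumr; apply: eq_bigr => w _.
by rewrite /G /weight big_cons invfM mulrA.
Qed.

Lemma domF_refl i j f : F f -> F (f \o refl i j).
Proof.
move=> Ff; have [/within_continuousP fc _] := Ff; apply/domFP; split; last first.
  by exists (E f f) => m; rewrite energyn_refl; exact: energyn_le_energy.
apply/within_continuousP => x Kx e e0.
have [dl dl0 H] := fc _ (refl_in i j Kx) e e0.
have /cvgrPdist_lt /(_ dl dl0) /nbhs_ballP [dl' dl'0 H'] := @refl_continuous i j x.
exists dl' => // y Ky xy; apply: H; first exact: refl_in.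
by apply: H'; rewrite -ball_normE.
Qed.

Lemma energy_refl i j f g : E (f \o refl i j) (g \o refl i j) = E f g.
Proof. by congr (limn _); apply/funext => m; rewrite energyn_refl. Qed.

(** * Harmonic functions *)

Local Notation harm := (harmonic_function q K c r).
Local Notation iota := (iota_ext q K c r).
Local Notation A := (Amap q K c r).

(** [h + t g] has the boundary values of [h] for every [t], so the first variation vanishes. With
    the converse that follows, this weak form makes harmonicity a linear condition. *)
Lemma harm_orthogonal h g : harm h -> F g -> (forall i, g (q i) = 0) -> E h g = 0.
Proof.
move=> [Fh hmin] Fg g0; set b := E h g; set e := E g g.
have e0 : 0 <= e by exact: energy_ge0.
have H t : 0 <= 2 * t * b + t ^+ 2 * e.
  have := hmin _ (domFD t Fh Fg).
  rewrite energyDl ?energyDr ?(energyC g h)//; last exact: domFD.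
  rewrite -/b -/e => /(_ _); have -> : (fun x => h x + t * g x) \o q = h \o q.
    by apply/funext => i /=; rewrite g0 mulr0 addr0.
  by move=> /(_ erefl); nra.
exact: quad_min e0 H.
Qed.

Lemma harm_of_orthogonal h : F h ->
  (forall g, F g -> (forall i, g (q i) = 0) -> E h g = 0) -> harm h.
Proof.
move=> Fh H; split => // g Fg gh.
have [k [Fk hk gE]] : exists k, [/\ F k, E h k = 0 & g = fun x => h x + 1 * k x].
  exists (fun x => g x + -1 * h x); split; first exact: domFD.
    apply: H; first exact: domFD.
    by move=> i; have := congr1 (@^~ i) gh; rewrite /= => ->; ring.
  by apply/funext => x; ring.
rewrite gE energyDl ?energyDr ?(energyC k h) ?hk//; last exact: domFD.
by have := energy_ge0 Fk; lra.
Qed.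

Lemma harm_dom h : harm h -> F h. Proof. by case. Qed.

Lemma harmD t h h' : harm h -> harm h' -> harm (fun x => h x + t * h' x).
Proof.
move=> hh hh'; apply: harm_of_orthogonal; first by apply: domFD; exact: harm_dom.
move=> g Fg g0; have [Fh Fh'] := (harm_dom hh, harm_dom hh').
by rewrite energyDl// !harm_orthogonal// mulr0 addr0.
Qed.

Lemma harm_const b : harm (fun=> b).
Proof.
apply: harm_of_orthogonal; first exact: domF_const.
by move=> g _ _; rewrite energy_constl.
Qed.

Lemma harm_unique h h' : harm h -> harm h' -> h \o q = h' \o q ->
  forall x, K x -> h x = h' x.
Proof.
move=> hh hh' hq x Kx; pose k x := h x + -1 * h' x.
have Fk : F k by apply: domFD; exact: harm_dom.
have k0 i : k (q i) = 0 by have := congr1 (@^~ i) hq; rewrite /k /= => ->; ring.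
have Ek : E k k = 0.
  have [Fh Fh'] := (harm_dom hh, harm_dom hh').
  by rewrite energyDl// !harm_orthogonal// mulr0 addr0.
by have := energy_eq0 Fk Ek Kx; rewrite k0 /k; lra.
Qed.

Lemma eq_harm h h' : (forall x, K x -> h x = h' x) -> harm h -> harm h'.
Proof.
move=> e [Fh H]; split; first exact: eq_domF Fh.
move=> g Fg gq; rewrite -(eq_energy e e); apply: H => //.
by rewrite gq; apply/funext => i /=; rewrite e//; exact: vertex_in.
Qed.

Lemma harm_refl i j h : harm h -> harm (h \o refl i j).
Proof.
move=> hh; apply: harm_of_orthogonal; first exact/domF_refl/harm_dom.
move=> g Fg g0; rewrite -(energy_refl i j).
have -> : (h \o refl i j) \o refl i j = h by apply/funext => x /=; rewrite reflK.
apply: harm_orthogonal => //; first exact: domF_refl.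
by move=> k /=; rewrite refl_vertex.
Qed.

(* A function supported in one cell is a legitimate test function. *)
Lemma harm_psi (a : S) h : harm h -> harm (h \o psi q a).
Proof.
move=> hh; apply: harm_of_orthogonal; first exact/domF_psi/harm_dom.
move=> g Fg g0.
have [|G HG] := @glue (fun b => if b == a then g else fun=> 0).
  by move=> b b' i j _; case: ifP; case: ifP; rewrite ?g0.
have FG : F G.
  apply: domF_glue => b; have := HG b; case: ifP => _ HGb.
    by apply: (@eq_domF g) => // x Kx; rewrite /= HGb.
  by apply: (@eq_domF (fun=> 0)); [move=> x Kx; rewrite /= HGb|exact: domF_const].
have := harm_orthogonal hh FG; rewrite energy_psi//; last exact: harm_dom.
rewrite (bigD1 a)//= big1 ?addr0; last first.
  move=> b ba; rewrite energyC (@eq_energy _ (fun=> 0) _ (h \o psi q b))//.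
    by rewrite energy_constl mulr0.
  by move=> x Kx /=; rewrite HG// (negbTE ba).
rewrite (@eq_energy _ (h \o psi q a) (G \o psi q a) g)//; last first.
  by move=> x Kx /=; rewrite HG// eqxx.
have Gq i : G (q i) = 0.
  by rewrite -(psi_vertex i) HG; [case: ifP|exact: vertex_in].
move=> /(_ Gq)/eqP; rewrite mulf_eq0 gt_eqF ?r_inv_gt0//=.
by move=> /eqP.
Qed.

Lemma harm_psiw (w : seq S) h : harm h -> harm (h \o psiw q w).
Proof. by elim: w h => [|a w IH] h hh //=; exact: IH _ (harm_psi a hh). Qed.

Context (hnd : nondegenerate_form q K c r).

(* [iota_ext] is [0] on boundary values without harmonic extension, and also on
   the boundary value [0]; hence injectivity of [Amap] provides extensions. *)
Lemma iotaP u : harm (iota u) /\ iota u \o q = u.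
Proof.
have iota0 x : K x -> iota (fun=> 0) x = 0.
  rewrite /iota_ext; case: xgetP => [h _ [hh hq]|//].
  by move=> Kx; exact: (harm_unique hh (harm_const 0) hq Kx).
rewrite /iota_ext; case: xgetP => [h _ //|nex].
have /bij_inj Ainj := hnd (vlabel ord0).
have u0 : u = fun=> 0.
  apply: Ainj; apply/funext => i; rewrite /Amap /=.
  rewrite iota0; last exact/psi_in/vertex_in.
  rewrite /iota_ext; case: xgetP => [h _ [hh hq]|//].
  by have := nex h; case.
by case: (nex (fun=> 0)); split; [exact: harm_const|rewrite u0].
Qed.

Lemma iota_harm u : harm (iota u). Proof. by case: (iotaP u). Qed.

Lemma iota_vertex u i : iota u (q i) = u i.
Proof. by case: (iotaP u) => _ /(congr1 (@^~ i)). Qed.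

Lemma harm_iota h u x : harm h -> (forall i, h (q i) = u i) -> K x -> h x = iota u x.
Proof.
move=> hh hq; apply: harm_unique => //; first exact: iota_harm.
by apply/funext => i /=; rewrite iota_vertex.
Qed.

Lemma iotaD t u u' x : K x -> iota (fun i => u i + t * u' i) x = iota u x + t * iota u' x.
Proof.
move=> Kx; apply/esym/(@harm_iota (fun x => iota u x + t * iota u' x)) => //.
  by apply: harmD; exact: iota_harm.
by move=> i; rewrite !iota_vertex.
Qed.

Lemma AmapD a t u u' i : A a (fun i => u i + t * u' i) i = A a u i + t * A a u' i.
Proof. by rewrite /Amap /= iotaD//; exact/psi_in/vertex_in. Qed.

Lemma Amap_const a b i : A a (fun=> b) i = b.
Proof.
rewrite /Amap /= -(harm_iota (harm_const b))//.
exact/psi_in/vertex_in.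
Qed.

Lemma iota_psi (a : S) u x : K x -> iota u (psi q a x) = iota (A a u) x.
Proof. by apply: (@harm_iota (iota u \o psi q a)) => //; exact/harm_psi/iota_harm. Qed.

Lemma iota_refl i j u x : K x -> iota (u \o tperm i j) x = iota u (refl i j x).
Proof.
move=> Kx; apply/esym/(@harm_iota (iota u \o refl i j)) => //.
  exact/harm_refl/iota_harm.
by move=> k /=; rewrite refl_vertex iota_vertex.
Qed.

Lemma Amap_tperm i j (a : S) u k :
  A (tlabel i j a) (u \o tperm i j) k = A a u (tperm i j k).
Proof.
rewrite /Amap /= iota_refl; last exact/psi_in/vertex_in.
by rewrite refl_psi tlabelK refl_vertex.
Qed.

Lemma iota_min f : F f -> E (iota (f \o q)) (iota (f \o q)) <= E f f.
Proof.
move=> Ff; case: (iota_harm (f \o q)) => _; apply => //.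
by apply/funext => i /=; rewrite iota_vertex.
Qed.

(** Truncation to [[0, 1]] is a contraction that keeps the boundary values, so the truncated
    function is again energy minimizing, and uniqueness identifies it with [iota u] on [K]. *)
Lemma iota_bounds u x : (forall i, 0 <= u i <= 1) -> K x -> 0 <= iota u x <= 1.
Proof.
move=> u01 Kx; pose g x := Num.max 0 (Num.min 1 (iota u x)).
have Fu : F (iota u) by exact/harm_dom/iota_harm.
have [Fg Eg] : F g /\ E g g <= E (iota u) (iota u).
  by apply: domF_contract => // y z _ _; exact: clamp_contract.
have hg : harm g.
  split=> // f Ff fg; apply: le_trans Eg _; case: (iota_harm u) => _; apply => //.
  rewrite fg; apply/funext => i; rewrite /= /g iota_vertex.
  by have /andP[u0 u1] := u01 i; rewrite min_r// max_r.
rewrite -(harm_iota hg)//; first by rewrite /g le_max lexx /= ge_max ler01 ge_min lexx.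
move=> i; rewrite /g iota_vertex.
by have /andP[u0 u1] := u01 i; rewrite min_r// max_r.
Qed.

Lemma piecewise_harmonic m (g : V -> R) : exists phi, F phi /\
  forall w : seq S, size w = m -> forall x, K x ->
    phi (psiw q w x) = iota (g \o psiw q w \o q) x.
Proof.
(* [q i] is also a vertex of the cell [i...i] of level [n]; this gives the boundary values of the
   pieces [G a] to be glued. *)
have psiw_vertex n i : psiw q (nseq n (vlabel i)) (q i) = q i.
  by elim: n => //= n ->; rewrite psi_vertex.
elim: m g => [|m IH] g.
  by exists (iota (g \o q)); split; [exact/harm_dom/iota_harm|case].
have [G HG] := choice (fun a : S => IH (g \o psi q a)).
have [|phi Hphi] := @glue G.
  have Gq a i : G a (q i) = g (psi q a (q i)).
    have [_ /(_ (nseq m (vlabel i)) (size_nseq _ _) (q i) (vertex_in i))] := HG a.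
    by rewrite psiw_vertex iota_vertex /= psiw_vertex.
  by move=> a b i j ab; rewrite !Gq ab.
exists phi; split.
  apply: domF_glue => a; apply: (@eq_domF (G a)); last by case: (HG a).
  by move=> x Kx; rewrite /= Hphi.
move=> [//|a w] [wm] x Kx /=; rewrite Hphi; last exact: psiw_in.
by case: (HG a) => _ ->.
Qed.

(** * Permutation-invariant forms, and positivity of harmonic functions *)

Lemma off_diagonal (T : eqType) (P : pred 'I_d.+1) (L : 'I_d.+1 -> 'I_d.+1 -> T) :
  (forall a b, P a -> P b -> forall x y, L (tperm a b x) (tperm a b y) = L x y) ->
  forall x y x' y', P x -> P y -> P x' -> P y' -> x != y -> x' != y' -> L x y = L x' y'.
Proof.
move=> H.
have H1 x y x' : P x -> P x' -> y != x -> y != x' -> L x y = L x' y.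
  by move=> Px Px' yx yx'; rewrite -(H x x')// tpermL tpermD 1?eq_sym.
have H2 x y y' : P y -> P y' -> x != y -> x != y' -> L x y = L x y'.
  by move=> Py Py' xy xy'; rewrite -(H y y')// tpermL tpermD 1?eq_sym.
move=> x y x' y' Px Py Px' Py' xy xy'.
have [x'y|x'y] := eqVneq x' y.
  rewrite -(H x y)// tpermL tpermR -x'y; apply: H2 => //; by rewrite x'y eq_sym.
by rewrite (H1 x y x') 1?eq_sym// 1?eq_sym// (H2 x' y y').
Qed.

Definition delta (i k : 'I_d.+1) : R := (k == i)%:R.

Lemma delta_tperm i a b : delta i \o tperm a b = delta (tperm a b i).
Proof.
apply/funext => k; rewrite /delta /=; congr (_%:R).
by congr nat_of_bool; apply/eqP/eqP => [<-|->]; rewrite tpermK.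
Qed.

Lemma delta_decomp (P : pred 'I_d.+1) (u : 'I_d.+1 -> R) k : P k ->
  \sum_(i | P i) u i * delta i k = u k.
Proof.
move=> Pk; rewrite (bigD1 k)//= /delta eqxx mulr1 big1 ?addr0// => i /andP[_ ik].
by rewrite eq_sym (negbTE ik) mulr0.
Qed.

Lemma linear_sum (B : ('I_d.+1 -> R) -> R) (P : pred 'I_d.+1) (b : R)
    (u : 'I_d.+1 -> R) (f : 'I_d.+1 -> 'I_d.+1 -> R) :
  (forall t u u', B (fun k => u k + t * u' k) = B u + t * B u') ->
  B (fun k => b + \sum_(i | P i) u i * f i k) = B (fun=> b) + \sum_(i | P i) u i * B (f i).
Proof.
move=> BD; elim: (index_enum _) => [|i ix IH].
  by rewrite big_nil addr0; congr B; apply/funext => k; rewrite big_nil addr0.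
rewrite big_cons; case: ifP => Pi; last first.
  by rewrite -IH; congr B; apply/funext => k; rewrite big_cons Pi.
rewrite addrCA addrC -IH -BD; congr B; apply/funext => k; rewrite big_cons Pi.
by rewrite addrCA addrC.
Qed.

Lemma ord_distinct (i : 'I_d.+1) : exists j k, [/\ j != i, k != i & j != k].
Proof.
have : (1 < #|predC1 i|)%N by rewrite cardC1 card_ord.
by case/card_gt1P => j [k []]; rewrite !inE => ji ki jk; exists j, k.
Qed.

(** In the basis [delta], invariance leaves a single off-diagonal value [la], and vanishing on
    constants forces the diagonal value [- d * la]: this is the matrix of [E0] up to a factor. *)
Lemma invariant_form (B : ('I_d.+1 -> R) -> ('I_d.+1 -> R) -> R) :
  (forall t u u' v, B (fun k => u k + t * u' k) v = B u v + t * B u' v) ->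
  (forall u v, B u v = B v u) -> (forall b v, B (fun=> b) v = 0) ->
  (forall i j u v, B (u \o tperm i j) (v \o tperm i j) = B u v) ->
  exists k, forall u v, B u v = k * E0 u v.
Proof.
move=> BD BC B0 BT; pose L i j := B (delta i) (delta j).
have BE u v : B u v = \sum_i u i * B (delta i) v.
  have /= := @linear_sum (B^~ v) xpredT 0 u delta (fun t u u' => BD t u u' v).
  rewrite B0 add0r => <-; congr B; apply/funext => k.
  by rewrite add0r delta_decomp.
have Loff := @off_diagonal _ xpredT L (fun a b _ _ x y => _).
have {}Loff x y x' y' : x != y -> x' != y' -> L x y = L x' y'.
  by apply: Loff => // {x y x' y'} a b x y; rewrite /L -!delta_tperm BT.
have [j [k [_ _ jk]]] := ord_distinct ord0.
set la := L j k.
have LE i i' : L i i' = la - la * d.+1%:R * (i == i')%:R.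
  have [<-|ii'] := eqVneq i i'; last by rewrite mulr0 subr0; exact: Loff.
  have : \sum_i' L i' i = 0.
    rewrite -[RHS](B0 1 (delta i)) [RHS]BE.
    by apply: eq_bigr => k' _; rewrite mul1r.
  rewrite (bigD1 i)//= (eq_bigr (fun=> la)) => [|k' k'i]; last exact: Loff.
  rewrite sumr_const cardC1 card_ord /= -mulr_natr => /eqP; rewrite addr_eq0 => /eqP ->.
  by rewrite -natr1; ring.
exists (- la / c) => u v; rewrite energy0E BE.
transitivity (\sum_i u i * (la * (\sum_i' v i') - la * d.+1%:R * v i)).
  apply: eq_bigr => i _; congr (_ * _); rewrite BC BE.
  rewrite (eq_bigr (fun i' => la * v i' - la * d.+1%:R * (v i' * delta i' i))).
    by rewrite sumrB -!mulr_sumr delta_decomp.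
  move=> i' _; rewrite BC [B _ _]LE /delta; ring.
rewrite (eq_bigr (fun i => la * (\sum_i' v i') * u i - la * d.+1%:R * (u i * v i))).
  rewrite sumrB -!mulr_sumr; field; exact: lt0r_neq0 c_gt0.
by move=> i _; ring.
Qed.

Lemma energy0_delta i : 0 < E0 (delta i) (delta i).
Proof.
rewrite lt0r energy0_ge0 ?ltW ?c_gt0// andbT; apply/eqP => /(energy0_eq0 c_gt0) H.
have [j [_ [ji _ _]]] := ord_distinct i.
have /eqP := H i j; rewrite /delta eqxx (negbTE ji).
by rewrite oner_eq0.
Qed.

(* [u |-> E (iota u)] is invariant under the symmetries, hence equal to [k * E0];
   [E0 <= E (iota u)] gives [1 <= k], and comparing [k * En m f f <= E f f] with
   the limit [m --> oo] gives [k <= 1]. *)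
Lemma energy_iota u v : E (iota u) (iota v) = E0 u v.
Proof.
have Fi w : F (iota w) by exact/harm_dom/iota_harm.
have [|||i j w z|k kE] := @invariant_form (fun u v => E (iota u) (iota v)).
- move=> t w w' z; rewrite -energyDl//; apply: eq_energy => // x Kx.
  by rewrite iotaD.
- by move=> w z; rewrite energyC.
- move=> b w; rewrite -(energy_constl b (iota w)); apply: eq_energy => // x Kx.
  by rewrite -(harm_iota (harm_const b)).
- rewrite -(energy_refl i j (iota w)); apply: eq_energy => x Kx; exact: iota_refl.
have iotaq w : iota w \o q = w by apply/funext => i; rewrite /= iota_vertex.
have e0 := energy0_delta ord0; set dl := delta ord0 in e0.
have ge1 : 1 <= k.
  have := energyn_le_energy 0 (Fi dl).
  by rewrite energyn0 iotaq kE -ler_pdivrMr// divff ?gt_eqF.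
have le m f : F f -> k * En m f f <= E f f.
  move=> Ff; rewrite (energy_psiw m Ff Ff) mulr_sumr; apply: ler_sum => w _.
  rewrite mulrCA ler_pM2l ?invr_gt0 ?weight_gt0// -kE.
  exact: iota_min (domF_psiw w Ff).
have : k * E (iota dl) (iota dl) <= E (iota dl) (iota dl).
  rewrite mulrC -ler_pdivlMr; last lra.
  by apply: energy_le => // m; rewrite ler_pdivlMr ?(mulrC _ k) ?le//; lra.
have k0 : 0 < k by lra.
rewrite kE -[leRHS]mul1r ler_pM2r ?mulr_gt0// => le1.
by rewrite kE (_ : k = 1) ?mul1r//; apply/le_anti; rewrite le1 ge1.
Qed.

Lemma harm_vertices h : harm h -> forall x, K x -> h x = iota (h \o q) x.
Proof. by move=> hh x; exact: harm_iota. Qed.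

Lemma energy_harm h h' : harm h -> harm h' -> E h h' = E0 (h \o q) (h' \o q).
Proof.
move=> hh hh'; rewrite -energy_iota; apply: eq_energy; exact: harm_vertices.
Qed.

(** The test function [chi] is the indicator of one vertex [x] outside the boundary. It is not
    continuous, so the variation is carried out at level 1, where [h] is still minimal because
    [En 1 h h <= E h h = E0] of its boundary values. As [h x = 0], all terms of [En 1 h chi] have
    the same sign, so each is zero, including that of the cell [a], which contains [x]. *)
Lemma strong_maximum h (a : S) m n : harm h -> (forall x, K x -> 0 <= h x) ->
  (forall k, psi q a (q m) != q k) -> h (psi q a (q m)) = 0 -> h (psi q a (q n)) = 0.
Proof.
move=> hh h0; set x := psi q a (q m) => xq hx.
pose chi (y : V) : R := (y == x)%:R.
have Kv (b : S) j : K (psi q b (q j)) by exact/psi_in/vertex_in.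
have orth : En 1 h chi = 0.
  apply: (quad_min (energyn_ge0 1 chi)) => t.
  have := energyn_le1 (fun y => h y + t * chi y).
  rewrite energyn0 (_ : _ \o q = h \o q); last first.
    by apply/funext => i; rewrite /= /chi eq_sym (negbTE (xq i)) mulr0 addr0.
  rewrite -energy_harm// => le1.
  have := le_trans (energyn_le_energy 1 (harm_dom hh)) le1.
  by rewrite energynDl !energynDr (energynC 1 chi h); nra.
have termE (b : S) : E0 (h \o psi q b \o q) (chi \o psi q b \o q) =
    - (c * ((\sum_i h (psi q b (q i))) * \sum_i chi (psi q b (q i)))).
  rewrite energy0E (eq_bigr (fun=> 0)) ?sumr_const ?mul0rn ?mulr0 ?sub0r ?mulrN//.
  by move=> i _ /=; rewrite /chi; case: eqP => [->|_]; rewrite ?hx ?mul0r ?mulr0.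
have chi0 y : 0 <= chi y by exact: ler0n.
have sum_ge0 (b : S) : 0 <= c * ((\sum_i h (psi q b (q i))) * \sum_i chi (psi q b (q i))).
  by rewrite !mulr_ge0 ?(ltW c_gt0)//; apply: sumr_ge0 => i _; [exact: h0|exact: chi0].
have : \sum_b (r b)^-1 * (c * ((\sum_i h (psi q b (q i))) * \sum_i chi (psi q b (q i)))) = 0.
  apply: oppr_inj; rewrite oppr0 -[RHS]orth energynS -sumrN; apply: eq_bigr => b _.
  by rewrite energyn0 termE mulrN.
move=> H; have := @psumr_eq0P _ _ _ _
  (fun b _ => mulr_ge0 (ltW (r_inv_gt0 b)) (sum_ge0 b)) H a isT.
move=> {H} /eqP.
rewrite !mulf_eq0 (gt_eqF (r_inv_gt0 a)) (gt_eqF c_gt0)/=.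
have chi1 : 0 < \sum_i chi (psi q a (q i)).
  by rewrite (bigD1 m)//= ltr_pwDl ?sumr_ge0// /chi eqxx ltr01.
rewrite (gt_eqF chi1) orbF => /eqP H.
exact: (@psumr_eq0P _ _ _ _ (fun i _ => h0 _ (Kv a i)) H n isT).
Qed.

(** A zero at [psi q (vlabel i) (q j)] would spread along the edge as far as [q j], where the value
    is 1; a zero at another [k] would spread to this vertex inside the cell. *)
Lemma iota_delta_gt0 i j k : j != i -> k != i ->
  0 < iota (delta j) (psi q (vlabel i) (q k)).
Proof.
move=> ji ki; set h := iota (delta j).
have hh : harm h by exact: iota_harm.
have h0 x : K x -> 0 <= h x.
  have d01 m : 0 <= delta j m <= 1 by rewrite /delta ler0n lern1 leq_b1.
  by move=> Kx; have /andP[] := iota_bounds d01 Kx.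
have not0 : h (psi q (vlabel i) (q j)) != 0.
  apply/eqP => hj0; have := @edge_path (fun x => h x = 0) i j.
  rewrite eq_sym => /(_ ji hj0) H.
  have /eqP := H (fun a m n aq h0' => strong_maximum n hh h0 aq h0').
  by rewrite /h iota_vertex /delta eqxx oner_eq0.
rewrite lt0r h0 ?andbT; last exact/psi_in/vertex_in.
apply/eqP => hk0; move/eqP: not0; apply; apply: strong_maximum hk0 => //.
move=> m; apply/eqP => /(congr1 (bary i)); rewrite bary_psi !bary_vertex vlabelE eqxx mul1n.
rewrite eq_sym (negbTE ki) add0r => /(canRL (divfK l_neq0))/eqP.
by rewrite -natrM eqr_nat => /eqP; case: (i == m); lia.
Qed.

(** * The maps [Amap] at the vertices of the simplex *)

Definition dev (u : 'I_d.+1 -> R) (i : 'I_d.+1) : R := u i - d.+1%:R^-1 * \sum_k u k.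

Lemma dev_sum u : \sum_i dev u i = 0.
Proof.
rewrite sumrB sumr_const card_ord -(mulr_natr (_ * _)) mulrAC mulVf ?mul1r ?subrr//.
Qed.

Lemma energy0_dev u v : E0 u v = c * d.+1%:R * \sum_i dev u i * dev v i.
Proof.
rewrite energy0E -mulrA; congr (_ * _).
set U := \sum_i u i; set W := \sum_i v i; set n : R := d.+1%:R.
have n0 : n != 0 by rewrite pnatr_eq0.
rewrite [in RHS](eq_bigr (fun i => u i * v i - n^-1 * W * u i - n^-1 * U * v i
  + n^-1 ^+ 2 * U * W)).
  rewrite big_split /= !sumrB -!mulr_sumr sumr_const card_ord -mulr_natr -/n -/U -/W.
  by field.
by move=> i _; rewrite /dev -/n -/U -/W; ring.
Qed.

Lemma tlabel_vertex i j k : i != j -> i != k -> tlabel j k (vlabel i) = vlabel i.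
Proof.
move=> ij ik; apply: label_eq => m; rewrite tlabelE !vlabelE; congr (_ * _)%N.
have e : tperm j k i = i by rewrite tpermD// eq_sym.
by rewrite -{1}e (inj_eq perm_inj).
Qed.

Lemma Amap_vertex i u : A (vlabel i) u i = u i.
Proof. by rewrite /Amap /= psi_vertex iota_vertex. Qed.

(* Normalized by [u i = 0], the map [A (vlabel i)] commutes with all permutations
   of the other vertices, hence equals [sg * id + be * (all-ones matrix)]; its
   entries [sg + be] and [be] are positive by the strong maximum principle. *)
Lemma Amap_vertex_ex i : exists sg be : R, [/\ sg != 0, 0 < be, 0 < sg + be &
  forall u k, k != i ->
    A (vlabel i) u k = u i + sg * (u k - u i) + be * \sum_j (u j - u i)].
Proof.
pose T := A (vlabel i); pose L j k := T (delta j) k.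
have LT a b : a != i -> b != i -> forall x y, L (tperm a b x) (tperm a b y) = L x y.
  rewrite eq_sym => ia; rewrite eq_sym => ib x y.
  by rewrite /L /T -{1}(tlabel_vertex ia ib) -delta_tperm Amap_tperm tpermK.
have [j0 [k0 [ji ki jk]]] := ord_distinct i.
set be := L j0 k0; set sg := L j0 j0 - be.
have Loff x y : x != i -> y != i -> x != y -> L x y = be.
  by move=> xi yi xy; apply: (@off_diagonal _ (fun j => j != i) L LT).
have Ldiag x : x != i -> L x x = sg + be.
  by move=> xi; rewrite /sg subrK -(LT x j0)// tpermL.
have be0 : 0 < be by apply: iota_delta_gt0.
have sgbe : 0 < sg + be by rewrite -(Ldiag j0 ji); apply: iota_delta_gt0.
have TE u k : k != i -> T u k = u i + sg * (u k - u i) + be * \sum_j (u j - u i).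
  move=> ik.
  have uE : u = fun k => u i + \sum_(j | j != i) (u j - u i) * delta j k.
    apply/funext => m; have [->|mi] := eqVneq m i.
      by rewrite big1 ?addr0// => j jm; rewrite /delta eq_sym (negbTE jm) mulr0.
    by rewrite (delta_decomp (P := fun j => j != i) (fun j => u j - u i))// addrC subrK.
  rewrite {1}uE (@linear_sum (T^~ k)); last by move=> t w w'; exact: AmapD.
  rewrite [T (fun=> _) k]Amap_const (bigD1 k)//= -/(L k k) Ldiag//.
  rewrite (eq_bigr (fun j => be * (u j - u i))); last first.
    by move=> j /andP[ji' jk']; rewrite -/(L j k) Loff// mulrC.
  rewrite -mulr_sumr [in RHS](bigD1 i)//= subrr add0r [in RHS](bigD1 k)//=; ring.
(* With [sg = 0], the difference [delta j0 - delta k0] would have image [0], against injectivity. *)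
exists sg, be; split => //; apply/eqP => sg0.
have /bij_inj Tinj := hnd (vlabel i).
have e : (fun k => delta j0 k + -1 * delta k0 k) = fun=> 0.
  apply: Tinj; apply/funext => m; rewrite Amap_const.
  have [->|mi] := eqVneq m i.
    by rewrite Amap_vertex /delta 2!(eq_sym i) (negbTE ji) (negbTE ki) mulr0 addr0.
  rewrite -/T TE// sg0 mul0r addr0.
  rewrite (_ : delta j0 i + -1 * delta k0 i = 0); last first.
    by rewrite /delta 2!(eq_sym i) (negbTE ji) (negbTE ki) mulr0 addr0.
  rewrite add0r (eq_bigr (fun k => 1 * delta j0 k - 1 * delta k0 k)) => [|k _]; last by ring.
  have sd x : \sum_k 1 * delta x k = 1.
    rewrite (bigD1 x)//= /delta eqxx mulr1 big1 ?addr0// => k /negbTE ->.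
    by rewrite mulr0.
  by rewrite sumrB !sd subrr mulr0.
have /eqP := congr1 (@^~ j0) e.
by rewrite /delta eqxx (negbTE jk) mulr0 addr0 oner_eq0.
Qed.

(** Centring removes the constants: the map acts as the scalar [sg] on [dev u i = 0], and its other
    eigenvalue is [sg + d * be]. *)
Lemma Amap_dev i : exists sg be : R, [/\ sg != 0, 0 < be, 0 < sg + be &
  forall u, dev (A (vlabel i) u) i = (sg + d%:R * be) * dev u i /\
    forall k, k != i -> dev (A (vlabel i) u) k = sg * dev u k - be * dev u i].
Proof.
have [sg [be [sg0 be0 sb0 H]]] := Amap_vertex_ex i.
exists sg, be; split=> // u; set m := d.+1%:R^-1 * \sum_k u k.
have n0 : d.+1%:R != 0 :> R by rewrite pnatr_eq0.
have sumE : \sum_j (u j - u i) = - (d.+1%:R * dev u i).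
  by rewrite sumrB sumr_const card_ord -mulr_natr /dev; field; rewrite nat1r.
have mE : d.+1%:R^-1 * \sum_k A (vlabel i) u k = u i - (sg + d%:R * be) * dev u i.
  rewrite (bigD1 i)//= Amap_vertex.
  rewrite (eq_bigr (fun k => u i + be * \sum_j (u j - u i) + sg * (u k - u i))); last first.
    by move=> k ki; rewrite H//; ring.
  rewrite big_split /= sumr_const cardC1 card_ord /= -mulr_sumr.
  have -> : \sum_(k < d.+1 | k != i) (u k - u i) = \sum_k (u k - u i).
    by rewrite [RHS](bigD1 i)//= subrr add0r.
  by rewrite sumE -mulr_natr; field; rewrite nat1r.
split=> [|k ki]; rewrite /dev -/(dev u _) mE; first by rewrite Amap_vertex; ring.
rewrite H// sumE -/(dev u i) -/m.
have -> : dev u i = u i - m by [].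
have -> : dev u k = u k - m by [].
by rewrite -[d.+1%:R]natr1; ring.
Qed.

(** Subtracting [sg ^ 2 * E0 u v] from the energy in the cell of vertex [i] leaves exactly
    [kap * (dev u i * dev v i)]. Since [d >= 2], [2 * sg + d * be >= 2 * (sg + be) > 0], whence
    [kap > 0] even if [sg] is negative. *)
Lemma dev_product_bound : exists2 C : R, 0 <= C & forall u v (eta : R),
  `|E0 u v| <= eta -> (forall a, `|E0 (A a u) (A a v)| <= eta) ->
  forall i, `|dev u i * dev v i| <= C * eta.
Proof.
have /choice[C HC] : forall i, exists C : R, 0 <= C /\ forall u v (eta : R),
  `|E0 u v| <= eta -> (forall a, `|E0 (A a u) (A a v)| <= eta) ->
  `|dev u i * dev v i| <= C * eta.
  move=> i; have [sg [be [sg0 be0 sb0 H]]] := Amap_dev i.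
  pose kap := c * d.+1%:R * (d.+1%:R * be * (2 * sg + d%:R * be)).
  have d2 : 2 <= d%:R :> R by rewrite ler_nat.
  have kap0 : 0 < kap.
    rewrite !mulr_gt0 ?c_gt0 ?ltr0n//; nra.
  exists (kap^-1 * (1 + sg ^+ 2)); split.
    by rewrite mulr_ge0 ?invr_ge0 ?(ltW kap0)// addr_ge0// sqr_ge0.
  move=> u v eta uv /(_ (vlabel i)) Auv.
  have E1 : E0 (A (vlabel i) u) (A (vlabel i) v) =
      sg ^+ 2 * E0 u v + kap * (dev u i * dev v i).
    rewrite !energy0_dev (bigD1 i)//= (H u).1 (H v).1.
    rewrite (eq_bigr (fun k => sg ^+ 2 * (dev u k * dev v k)
      - sg * be * dev v i * dev u k - sg * be * dev u i * dev v k
      + be ^+ 2 * dev u i * dev v i)); last first.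
      by move=> k ki; rewrite (H u).2// (H v).2//; ring.
    rewrite big_split /= !sumrB -!mulr_sumr sumr_const cardC1 card_ord -mulr_natr /=.
    have su w : \sum_(k < d.+1 | k != i) dev w k = - dev w i.
      by have /eqP := dev_sum w; rewrite (bigD1 i)//= addrC addr_eq0 => /eqP.
    rewrite !su [in RHS](bigD1 i)//= /kap -[d.+1%:R]natr1; ring.
  have -> : dev u i * dev v i = kap^-1 *
      (E0 (A (vlabel i) u) (A (vlabel i) v) - sg ^+ 2 * E0 u v).
    by rewrite E1 addrAC subrr add0r mulKf// gt_eqF.
  clearbody kap; have ki0 : 0 < kap^-1 by rewrite invr_gt0.
  rewrite normrM -[leRHS]mulrA (gtr0_norm ki0) (ler_pM2l ki0).
  rewrite (le_trans (ler_normB _ _))// mulrDl mul1r lerD//.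
  by rewrite normrM ger0_norm ?sqr_ge0// ler_wpM2l// sqr_ge0.
have C0 i : 0 <= C i by case: (HC i).
exists (\sum_i C i); first by apply: sumr_ge0 => i _.
move=> u v eta uv Auv i; have [_ /(_ _ _ _ uv Auv) Hi] := HC i.
apply: le_trans Hi _; rewrite ler_wpM2r ?(le_trans _ uv)//.
by rewrite (bigD1 i)//= lerDl; apply: sumr_ge0.
Qed.

(** The previous bound at index [j], applied to the images under the map at vertex [i], controls
    [(sg x_j - be x_i) (sg y_j - be y_i)], with [x], [y] the centred values. Expanding and
    discarding the diagonal products leaves the cross term times [sg * be], and [sg != 0] allows the
    division. *)
Lemma cross_bound : exists2 C : R, 0 <= C & forall u v (eta : R),
  `|E0 u v| <= eta -> (forall a, `|E0 (A a u) (A a v)| <= eta) ->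
  (forall a b, `|E0 (A b (A a u)) (A b (A a v))| <= eta) ->
  forall i j, `|dev u i * dev v j + dev u j * dev v i| <= C * eta.
Proof.
have [C0 C00 H0] := dev_product_bound.
have /choice[C HC] : forall i, exists C : R, 0 <= C /\ forall u v (eta : R),
  `|E0 u v| <= eta -> (forall a, `|E0 (A a u) (A a v)| <= eta) ->
  (forall a b, `|E0 (A b (A a u)) (A b (A a v))| <= eta) ->
  forall j, `|dev u i * dev v j + dev u j * dev v i| <= C * eta.
  move=> i; have [sg [be [sg0 be0 sb0 H]]] := Amap_dev i.
  have sb1 : sg * be != 0 by rewrite mulf_neq0// gt_eqF.
  pose Z := `|sg * be|^-1 * (C0 + sg ^+ 2 * C0 + be ^+ 2 * C0).
  have Z0 : 0 <= Z.
    apply: mulr_ge0; first by rewrite invr_ge0 normr_ge0.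
    have := sqr_ge0 sg; have := sqr_ge0 be; nra.
  exists (2 * C0 + Z); split; first by rewrite addr_ge0// mulr_ge0.
  move=> u v eta uv Auv AAuv j.
  have eta0 : 0 <= eta by exact: le_trans uv.
  have [->|ji] := eqVneq j i.
    have := ler_normD (dev u i * dev v i) (dev u i * dev v i).
    by have := H0 _ _ _ uv Auv i; have := mulr_ge0 Z0 eta0; rewrite mulrDl; lra.
  have := H0 _ _ _ (Auv (vlabel i)) (AAuv (vlabel i)) j.
  rewrite (H u).2// (H v).2// => Hj.
  have -> : dev u i * dev v j + dev u j * dev v i = (sg * be)^-1 *
      (sg ^+ 2 * (dev u j * dev v j) + be ^+ 2 * (dev u i * dev v i)
       - (sg * dev u j - be * dev u i) * (sg * dev v j - be * dev v i)).
    by field; rewrite sg0 gt_eqF.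
  apply: (@le_trans _ _ (Z * eta)); last by rewrite ler_wpM2r// lerDr mulr_ge0.
  rewrite normrM normfV /Z -[leRHS]mulrA ler_wpM2l ?invr_ge0//.
  have B t x : `|x| <= C0 * eta -> `|t ^+ 2 * x| <= t ^+ 2 * C0 * eta.
    by move=> xC; rewrite normrM ger0_norm ?sqr_ge0// -mulrA ler_wpM2l// sqr_ge0.
  have B1 := B sg _ (H0 _ _ _ uv Auv j); have B2 := B be _ (H0 _ _ _ uv Auv i).
  rewrite (le_trans (ler_normB _ _))//.
  have := ler_normD (sg ^+ 2 * (dev u j * dev v j)) (be ^+ 2 * (dev u i * dev v i)).
  by move: Hj B1 B2; rewrite !mulrDl; lra.
have C1 i : 0 <= C i by case: (HC i).
exists (\sum_i C i); first by apply: sumr_ge0 => i _.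
move=> u v eta uv Auv AAuv i j; have [_ /(_ _ _ _ uv Auv AAuv j) Hi] := HC i.
apply: le_trans Hi _; rewrite ler_wpM2r ?(le_trans _ uv)//.
by rewrite (bigD1 i)//= lerDl; apply: sumr_ge0.
Qed.

(* Quantitative form of: if [E0 (A_w u) (A_w v) = 0] for all words [w] of length
   at most 2, then [u] or [v] is constant. *)
Lemma energy0_product_bound : exists2 C : R, 0 <= C & forall u v (eta : R),
  `|E0 u v| <= eta -> (forall a, `|E0 (A a u) (A a v)| <= eta) ->
  (forall a b, `|E0 (A b (A a u)) (A b (A a v))| <= eta) ->
  E0 u u * E0 v v <= C * eta ^+ 2.
Proof.
have [C C0 H] := cross_bound.
exists (c ^+ 2 * d.+1%:R ^+ 2 * (d.+1%:R ^+ 2 * C ^+ 2)).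
  by rewrite -!exprMn sqr_ge0.
move=> u v eta uv Auv AAuv; have {}H := H _ _ _ uv Auv AAuv.
have eta0 : 0 <= eta by exact: le_trans uv.
have P2 : \sum_i \sum_j (dev u i * dev v j + dev u j * dev v i) ^+ 2 =
    2 * ((\sum_i dev u i * dev u i) * (\sum_j dev v j * dev v j))
    + 2 * (\sum_i dev u i * dev v i) ^+ 2.
  rewrite (eq_bigr (fun i => (dev u i * dev u i) * (\sum_j dev v j * dev v j)
    + (dev v i * dev v i) * (\sum_j dev u j * dev u j)
    + 2 * (dev u i * dev v i) * (\sum_j dev u j * dev v j))).
    by rewrite !big_split /= -!mulr_suml -mulr_sumr; ring.
  move=> i _; rewrite !mulr_sumr -!big_split; apply: eq_bigr => j _ /=; ring.
have P2le : \sum_i \sum_j (dev u i * dev v j + dev u j * dev v i) ^+ 2 <=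
    \sum_(i < d.+1) \sum_(j < d.+1) (C * eta) ^+ 2.
  apply: ler_sum => i _; apply: ler_sum => j _.
  by rewrite -real_normK ?num_real// lerXn2r ?nnegrE// mulr_ge0.
move: P2le; rewrite P2 !sumr_const card_ord -mulrnA -(mulr_natr (_ ^+ 2)) natrM => P2le.
rewrite !energy0_dev.
have := sqr_ge0 (\sum_i dev u i * dev v i); move: P2le.
set X := \sum_i _; set Y := \sum_i _; set Z := \sum_i _; set n : R := d.+1%:R.
move=> H1 H2; have XY : X * Y <= (C * eta) ^+ 2 * (n * n).
  have : 0 <= (C * eta) ^+ 2 * (n * n) by rewrite mulr_ge0 ?sqr_ge0// -expr2 sqr_ge0.
  by lra.
rewrite (_ : _ * X * _ = (c * n) ^+ 2 * (X * Y)); last by ring.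
rewrite (_ : _ * eta ^+ 2 = (c * n) ^+ 2 * ((C * eta) ^+ 2 * (n * n))); last by ring.
by rewrite ler_wpM2l// sqr_ge0.
Qed.

(** * Finite Borel measures on the gasket *)

Local Notation borel := (borelV R d).

Lemma open_borel (U : set V) : open U -> measurable (U : set borel).
Proof. exact: sub_sigma_algebra. Qed.

Lemma K_borel : measurable (K : set borel).
Proof.
rewrite -[K]setCK; apply: measurableC; apply: open_borel.
by rewrite openC; apply: compact_closed (@norm_hausdorff _ _) _; case: hK.
Qed.

Lemma psiw_borel (w : seq S) : measurable_fun setT (psiw q w : borel -> borel).
Proof.
apply: (@measurability _ _ borel borel setT _ (@open V) (erefl _)) => _ [U oU <-].
rewrite setTI; apply: open_borel; apply: open_comp oU => x _.
exact: psiw_continuous.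
Qed.

Lemma psiw_preimage_borel (w : seq S) (A : set borel) :
  measurable A -> measurable (psiw q w @^-1` A : set borel).
Proof. by move=> mA; rewrite -[X in measurable X]setTI; exact: psiw_borel. Qed.

Lemma continuous_within_borel (f : V -> R) : {within K, continuous f} ->
  measurable_fun (K : set borel) (f : borel -> R).
Proof.
move=> fc; apply: (@measurability _ _ borel R K f _ (RGenOInfty.measurableE R)).
move=> _ [_ [x ->] <-].
have oP : open (f @^-1` `]x, +oo[ : set (subspace K)).
  by move/continuousP : fc; apply; exact: interval_open.
have /open_subspaceP [U oU UE] := oP.
rewrite setIC -UE; apply: measurableI; first exact: open_borel.
exact: K_borel.
Qed.

Section FiniteMeasure.
Context (m : {finite_measure set borel -> \bar R}).

Lemma finite_measureE (A : set borel) : measurable A -> m A = (fine (m A))%:E.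
Proof. by move=> mA; rewrite fineK// fin_num_measure. Qed.

Lemma fine_measure_ge0 (A : set borel) : 0 <= fine (m A).
Proof. by rewrite fine_ge0. Qed.

Lemma fine_measure_le (A B : set borel) : measurable A -> measurable B ->
  A `<=` B -> fine (m A) <= fine (m B).
Proof.
move=> mA mB AB; rewrite fine_le ?fin_num_measure//.
by rewrite le_measure// inE.
Qed.

Lemma fine_measureU (A B : set borel) : measurable A -> measurable B ->
  A `&` B = set0 -> fine (m (A `|` B)) = fine (m A) + fine (m B).
Proof.
by move=> mA mB AB; rewrite measureU// fineD ?fin_num_measure.
Qed.

Lemma fine_measureD (A B : set borel) : measurable A -> measurable B ->
  A `<=` B -> fine (m (B `\` A)) = fine (m B) - fine (m A).
Proof.
move=> mA mB AB; have mBA := measurableD mB mA.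
have H : A `&` (B `\` A) = set0 by rewrite setIDA setIC -setIDA setDv setI0.
have := fine_measureU mA mBA H; rewrite setDUK// => ->.
by rewrite addrAC subrr add0r.
Qed.

Lemma fine_measureUC (A : set borel) : measurable A ->
  fine (m A) + fine (m (~` A)) = fine (m setT).
Proof.
move=> mA; rewrite -fine_measureU ?setUv//; last exact: setICr.
exact: measurableC.
Qed.

Lemma fine_measureU_le (A B : set borel) : measurable A -> measurable B ->
  fine (m (A `|` B)) <= fine (m A) + fine (m B).
Proof.
move=> mA mB; have mBA := measurableD mB mA.
rewrite -(setDUK (@subsetUl _ A B)) setDUl setDv set0U.
rewrite fine_measureU//; last by rewrite setIDA setIC -setIDA setDv setI0.
by apply: lerD => //; apply: fine_measure_le => //; exact: subDsetl.
Qed.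

Lemma fine_measure_sum (A : (set borel)^nat) : (forall n, measurable (A n)) ->
  trivIset setT A ->
  \sum_(0 <= k < n) fine (m (A k)) @[n --> \oo] --> fine (m (\bigcup_n A n)).
Proof.
move=> mA tA; have mU : measurable (\bigcup_n A n) by exact: bigcupT_measurable.
have H : \sum_(0 <= k < n) m (A k) @[n --> \oo] --> (fine (m (\bigcup_n A n)))%:E.
  by rewrite -finite_measureE//; exact: measure_semi_sigma_additive.
apply: cvg_trans (@fine_cvg _ _ _ _ _ _ H); apply: near_eq_cvg.
by apply: nearW => n /=; rewrite sum_fine// => i _; exact: fin_num_measure.
Qed.

Lemma fine_measure_nondecreasing (A : (set borel)^nat) : (forall n, measurable (A n)) ->
  {homo A : n k / (n <= k)%N >-> (n <= k)%O} ->
  fine (m (A n)) @[n --> \oo] --> fine (m (\bigcup_n A n)).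
Proof.
move=> mA hA; have mU : measurable (\bigcup_n A n) by exact: bigcupT_measurable.
have H : m (A n) @[n --> \oo] --> (fine (m (\bigcup_n A n)))%:E.
  by rewrite -finite_measureE//; exact: nondecreasing_cvg_mu.
exact: (@fine_cvg _ _ _ _ _ _ H).
Qed.

End FiniteMeasure.

Lemma carried_eq (m : {finite_measure set borel -> \bar R}) (A B : set borel) :
  carried K m -> measurable A -> measurable B -> A `&` K = B `&` K -> m A = m B.
Proof.
have H (X : set borel) : carried K m -> measurable X -> m X = m (X `&` K).
  move=> cK mX; have XK0 : m (X `\` K) = 0%E.
    apply/eqP; rewrite eq_le measure_ge0 andbT -[leRHS]cK le_measure ?inE//.
    - by apply: measurableD => //; exact: K_borel.
    - by apply: measurableC; exact: K_borel.
  apply: etrans (measureDI m mX K_borel) _.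
  by apply: etrans (congr1 (fun z => z + _)%E XK0) _; rewrite add0e.
by move=> cK mA mB AB; rewrite (H A)// AB -H.
Qed.

(* [phi n] is the piecewise harmonic function of level [n] equal to [1] at those
   vertices all of whose level [n] cells lie in [U], and to [0] at the others. *)
Lemma open_cutoff (U : set V) : open U -> exists phi : nat -> V -> R, forall n,
  [/\ F (phi n), forall x, K x -> 0 <= phi n x <= 1 &
    forall x, K x -> phi k x @[k --> \oo] --> (\1_U x : R)].
Proof.
move=> oU.
pose inside n (y : V) := forall w : n.-tuple S, (exists2 z, K z & psiw q w z = y) ->
  forall x, K x -> U (psiw q w x).
pose g n y : R := if `[< inside n y >] then 1 else 0.
have [phi Hphi] := choice (fun n => piecewise_harmonic n (g n)).
exists phi => n; split; first by case: (Hphi n).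
  move=> x /(psiw_ex n)[w [z [Kz ->]]]; case: (Hphi n) => _ ->//; last exact: size_tuple.
  by apply: iota_bounds => // i; rewrite /g /=; case: ifP; rewrite ?lexx ?ler01.
move=> x Kx; rewrite indicE; have [Ux|nUx] := pselect (U x); last first.
  rewrite memNset//; apply: cvg_near_cst; apply: nearW => k.
  have [w [z [Kz xE]]] := psiw_ex k Kx.
  rewrite {1}xE; case: (Hphi k) => _ ->//; last exact: size_tuple.
  rewrite (_ : g k \o psiw q w \o q = fun=> 0) -?(harm_iota (harm_const 0))//.
  apply/funext => i; rewrite /g /=; case: asboolP => // H; exfalso; apply: nUx.
  by rewrite xE; apply: H => //; exists (q i) => //; exact: vertex_in.
rewrite mem_set//; apply: cvg_near_cst.
have /nbhs_ballP[e /= e0 He] : nbhs x U by exact: open_nbhs_nbhs.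
have e20 : 0 < e / 2 by rewrite divr_gt0.
have [m0 small] := cells_small e20.
exists m0 => // k /= m0k; have [w [z [Kz xE]]] := psiw_ex k Kx.
rewrite {1}xE; case: (Hphi k) => _ ->//; last exact: size_tuple.
rewrite (_ : g k \o psiw q w \o q = fun=> 1) -?(harm_iota (harm_const 1))//.
apply/funext => i; rewrite /g /=; case: asboolP => // H; exfalso; apply: H.
move=> w' [z' Kz' z'E] x' Kx'; apply: He; rewrite -ball_normE /=.
rewrite -(subrK (psiw q w (q i)) x) -addrA (le_lt_trans (ler_normD _ _))//.
rewrite [e]splitr ltrD//.
  by rewrite xE; apply: small => //; exact: vertex_in.
by rewrite -z'E; apply: small.
Qed.

(** A linear relation between integrals of domain functions passes to open sets through cutoffs and
    dominated convergence, then to Borel sets by Dynkin induction. Signed coefficients and image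
    measures under [psiw] let it cover both self-similarity and polarization. *)
Lemma integral_determines (I : finType) (cf : I -> R)
    (m : I -> {finite_measure set borel -> \bar R}) (w : I -> seq S) :
  (forall i, carried K (m i)) ->
  (forall phi, F phi ->
     \sum_i cf i * fine (\int[m i]_(x in K) (phi (psiw q (w i) x))%:E) = 0) ->
  forall A : set borel, measurable A ->
  \sum_i cf i * fine (m i (psiw q (w i) @^-1` A)) = 0.
Proof.
move=> cm H A mA; pose P (A : set borel) :=
  \sum_i cf i * fine (m i (psiw q (w i) @^-1` A)) = 0.
have Popen (U : set V) : open U -> P U.
  move=> oU; have [phi Hphi] := open_cutoff oU.
  have Fphi n : F (phi n) by case: (Hphi n).
  have lim i : fine (\int[m i]_(x in K) (phi n (psiw q (w i) x))%:E) @[n --> \oo] -->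
      fine (m i (psiw q (w i) @^-1` U)).
    have mU := psiw_preimage_borel (w i) (open_borel oU).
    rewrite (_ : m i _ = (\int[m i]_(x in K) (\1_(psiw q (w i) @^-1` U) x)%:E)%E); last first.
      rewrite integral_indic//; last exact: K_borel.
      apply: carried_eq => //; first by apply: measurableI => //; exact: K_borel.
      by rewrite -setIA setIid.
    apply: fine_cvg; rewrite fineK; last first.
      rewrite integral_indic//; last exact: K_borel.
      by rewrite fin_num_measure//; apply: measurableI => //; exact: K_borel.
    apply: (@dominated_cvg _ _ _ (m i) K K_borel _ _ (EFin \o cst 1)) => //.
    - move=> n; apply/measurable_EFinP; apply: continuous_within_borel.
      by case: (domF_psiw (w i) (Fphi n)).
    - move=> x Kx; apply/fine_cvgP; split; first exact: nearW.
      by have [_ _] := Hphi 0%N; apply; exact: psiw_in.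
    - by apply: finite_measure_integrable_cst; exact: K_borel.
    - move=> n x Kx /=; rewrite lee_fin.
      have [_ /(_ _ (psiw_in (w i) Kx))/andP[p0 p1] _] := Hphi n.
      by rewrite ger0_norm.
  rewrite /P; have /cvg_lim <-// :
      \sum_i cf i * fine (\int[m i]_(x in K) (phi n (psiw q (w i) x))%:E)
      @[n --> \oo] --> \sum_i cf i * fine (m i (psiw q (w i) @^-1` U)).
    apply: (cvg_big add_continuous) => i _; apply: cvgM; first exact: cvg_cst.
    exact: lim.
  by rewrite (_ : (fun n => _) = fun=> 0) ?lim_cst//; apply/funext => n; exact: H.
apply: (@dynkin_induction _ borel (@open V) P (erefl _)) => //.
- by move=> B C oB oC; exact: openI.
- exact/Popen/openT.
- move=> B mB PB; rewrite /P.
  rewrite (eq_bigr (fun i => cf i * fine (m i setT) - cf i * fine (m i (psiw q (w i) @^-1` B)))).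
    rewrite sumrB [X in _ - X]PB subr0; exact: Popen openT.
  move=> i _; rewrite -mulrBr; congr (_ * _).
  rewrite -(fine_measureUC (m i) (psiw_preimage_borel (w i) mB)).
  by rewrite addrC addKr preimage_setC.
- move=> B mB tB PB; rewrite /P.
  have lim i : \sum_(0 <= k < n) fine (m i (psiw q (w i) @^-1` (B k))) @[n --> \oo] -->
      fine (m i (psiw q (w i) @^-1` (\bigcup_k B k))).
    rewrite preimage_bigcup; apply: fine_measure_sum => [n|].
      exact: psiw_preimage_borel.
    by move=> i' j' _ _ [x [H1 H2]]; apply: tB => //; exists (psiw q (w i) x).
  have /cvg_lim <-// : \sum_i cf i * (\sum_(0 <= k < n) fine (m i (psiw q (w i) @^-1` (B k))))
      @[n --> \oo] --> \sum_i cf i * fine (m i (psiw q (w i) @^-1` (\bigcup_k B k))).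
    apply: (cvg_big add_continuous) => i _; apply: cvgM; first exact: cvg_cst.
    exact: lim.
  rewrite (_ : (fun n => _) = fun=> 0) ?lim_cst//; apply/funext => n.
  under eq_bigr do rewrite mulr_sumr.
  by rewrite exchange_big big1// => k _; exact: PB.
Qed.

(** * Energy measures *)

Context (nu : (V -> R) -> {finite_measure set borel -> \bar R})
  (hnu : forall f, F f -> is_energy_measure q K c r f (nu f)).

Local Notation mass f A := (fine (nu f A)).

Lemma nu_carried f : F f -> carried K (nu f).
Proof. by case/hnu. Qed.

Lemma nu_integral f phi : F f -> F phi ->
  fine (\int[nu f]_(x in K) (phi x)%:E) = 2 * E (f \* phi) f - E phi (f \* f).
Proof. by case/hnu => _ H /H ->. Qed.

Lemma nu_linear (I : finType) (cf : I -> R) (f : I -> V -> R) (w : I -> seq S) :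
  (forall i, F (f i)) ->
  (forall phi, F phi -> \sum_i cf i * (2 * E (f i \* (phi \o psiw q (w i))) (f i)
      - E (phi \o psiw q (w i)) (f i \* f i)) = 0) ->
  forall A : set borel, measurable A ->
  \sum_i cf i * mass (f i) (psiw q (w i) @^-1` A) = 0.
Proof.
move=> Ff H A mA; apply: (@integral_determines _ cf (fun i => nu (f i))) => //.
  by move=> i; exact: nu_carried.
move=> phi Fphi; rewrite -[RHS](H phi Fphi); apply: eq_bigr => i _; congr (_ * _).
exact: nu_integral (domF_psiw (w i) Fphi).
Qed.

Lemma nu_psiw m f (A : set borel) : F f -> measurable A ->
  mass f A = \sum_(w : m.-tuple S) (weight r w)^-1 *
     mass (f \o psiw q w) (psiw q w @^-1` A).
Proof.
move=> Ff mA.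
(* The identity is read as a vanishing sum: the ['I_1] summand is [nu f] itself, the words carry
   [- 1 / weight r w]. *)
have := @nu_linear _ (fun o : 'I_1 + m.-tuple S => if o is inr w then - (weight r w)^-1 else 1)
  (fun o => if o is inr w then f \o psiw q w else f)
  (fun o => if o is inr w then val w else [::]) (fun o => _) _ A mA.
rewrite big_sumType /= big_ord1 mul1r => H; apply/eqP; rewrite -subr_eq0; apply/eqP.
rewrite -[RHS]H; last 2 first.
- by case=> [//|w]; exact: domF_psiw.
- move=> phi Fphi; rewrite big_sumType /= big_ord1 mul1r.
  rewrite (energy_psiw m (domFM Ff Fphi) Ff) (energy_psiw m Fphi (domFM Ff Ff)).
  rewrite mulr_sumr -sumrB -big_split big1//= => w _.
  by rewrite (_ : (f \* phi) \o psiw q w = (f \o psiw q w) \* (phi \o psiw q w))//; ring.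
by rewrite -sumrN; congr (_ + _); apply: eq_bigr => w _; rewrite mulNr.
Qed.

(** The mutual energy measure by polarization; the factors [1] and [-1] keep the shape [f + t * g]
    of [nu_quadratic]. *)
Definition cross_mass (f g : V -> R) (A : set borel) : R :=
  (mass (fun x => f x + 1 * g x) A - mass (fun x => f x + -1 * g x) A) / 4.

Lemma nu_quadratic t f g (A : set borel) : F f -> F g -> measurable A ->
  mass (fun x => f x + t * g x) A =
    mass f A + 2 * t * cross_mass f g A + t ^+ 2 * mass g A.
Proof.
move=> Ff Fg mA.
(* The relation is [nu (f + t g) - nu f - t ^ 2 nu g - (t / 2) (nu (f + g) - nu (f - g)) = 0]. *)
pose cf (i : 'I_5) : R := nth 0 [:: 1; -1; - t ^+ 2; - (t / 2); t / 2] i.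
pose h (i : 'I_5) : V -> R := nth f [:: (fun x => f x + t * g x); f; g;
  (fun x => f x + 1 * g x); (fun x => f x + -1 * g x)] i.
have Fh i : F (h i).
  by rewrite /h; case: i => -[|[|[|[|[|//]]]]] _ //=; exact: domFD.
suff H : forall phi, F phi -> \sum_i cf i * (2 * E (h i \* (phi \o psiw q ([::] : seq S))) (h i)
    - E (phi \o psiw q ([::] : seq S)) (h i \* h i)) = 0.
  have := @nu_linear _ cf h (fun=> [::]) Fh H A mA.
  by rewrite !big_ord_recl big_ord0 /cf /h /= !preimage_id /cross_mass; lra.
move=> phi Fphi; rewrite !big_ord_recl big_ord0 /cf /h /=.
have Q t' : 2 * E ((fun x => f x + t' * g x) \* phi) (fun x => f x + t' * g x)
    - E phi ((fun x => f x + t' * g x) \* (fun x => f x + t' * g x)) =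
  (2 * E (f \* phi) f - E phi (f \* f)) + t' * (2 * E (f \* phi) g + 2 * E (g \* phi) f
     - 2 * E phi (f \* g)) + t' ^+ 2 * (2 * E (g \* phi) g - E phi (g \* g)).
  have Ffp := domFM Ff Fphi; have Fgp := domFM Fg Fphi.
  have Fff := domFM Ff Ff; have Ffg := domFM Ff Fg; have Fgg := domFM Fg Fg.
  rewrite (_ : (fun x => f x + t' * g x) \* phi =
    fun x => (f \* phi) x + t' * (g \* phi) x); last by apply/funext => x /=; ring.
  rewrite (_ : (fun x => f x + t' * g x) \* (fun x => f x + t' * g x) =
    fun x => ((fun x => (f \* f) x + (2 * t') * (f \* g) x) x) + t' ^+ 2 * (g \* g) x);
    last by apply/funext => x /=; ring.
  rewrite (energyDr _ _ Fgg Fphi); last exact: domFD.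
  rewrite (energyDr _ Fff Ffg Fphi) (energyDl _ Ffp Fgp); last exact: domFD.
  by rewrite (energyDr _ Ff Fg Ffp) (energyDr _ Ff Fg Fgp); ring.
rewrite (_ : phi \o id = phi)// (Q t) (Q 1) (Q (-1)).
move: (2 * E (f \* phi) f - _) (2 * E (f \* phi) g + _ - _) (2 * E (g \* phi) g - _).
by move=> a b e; field.
Qed.

Lemma mass_total f : F f -> mass f setT = 2 * E f f.
Proof.
move=> Ff; have := nu_integral Ff (domF_const 1).
rewrite integral_cst; last exact: K_borel.
have KT : nu f K = nu f setT.
  apply: carried_eq => //; [exact: nu_carried|exact: K_borel|].
  by rewrite setTI setIid.
rewrite mul1e => H; apply: etrans (congr1 fine (esym KT)) _; apply: etrans H _.
rewrite energy_constl subr0; congr (2 * _); apply: eq_energy => // x _ /=.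
by rewrite mulr1.
Qed.

Lemma cross_mass_total f g : F f -> F g -> cross_mass f g setT = 2 * E f g.
Proof.
move=> Ff Fg; have := nu_quadratic 1 Ff Fg measurableT.
rewrite !mass_total//; last exact: domFD.
rewrite energyDl ?energyDr// ?(energyC g f); last exact: domFD.
by move=> H; lra.
Qed.

Lemma cross_massUC f g (A : set borel) : measurable A ->
  cross_mass f g A + cross_mass f g (~` A) = cross_mass f g setT.
Proof.
by move=> mA; rewrite /cross_mass -!(fine_measureUC _ mA); field.
Qed.

Lemma cross_mass_sqr_le f g (A : set borel) : F f -> F g -> measurable A ->
  cross_mass f g A ^+ 2 <= mass f A * mass g A.
Proof.
move=> Ff Fg mA; apply: quad_discr => // [||t]; [exact: fine_measure_ge0..|].
by rewrite -nu_quadratic//; exact: fine_measure_ge0.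
Qed.

(** The mutual measure vanishes on [A], so its mass on the complement is [2 * E f g]; Cauchy-Schwarz
    there, with [nu g] of total mass [2 * E g g], gives the bound. *)
Lemma energy_le_of_null f g (A : set borel) : F f -> F g -> measurable A ->
  mass g A = 0 -> 2 * E f g ^+ 2 <= mass f (~` A) * E g g.
Proof.
move=> Ff Fg mA gA; have mC := measurableC mA.
have H0 : cross_mass f g A = 0.
  apply/eqP; rewrite -sqrf_eq0; apply/eqP/le_anti; rewrite sqr_ge0 andbT.
  by rewrite (le_trans (cross_mass_sqr_le Ff Fg mA))// gA mulr0.
have := cross_mass_sqr_le Ff Fg mC.
have := cross_massUC f g mA; rewrite H0 add0r cross_mass_total// => ->.
have : mass g (~` A) <= 2 * E g g.
  by rewrite -mass_total// fine_measure_le.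
have := fine_measure_ge0 (nu f) (~` A); nra.
Qed.

Lemma mass_psiw_le (w : seq S) f (A : set borel) : F f -> measurable A ->
  mass (f \o psiw q w) (psiw q w @^-1` A) <= mass f A.
Proof.
move=> Ff mA.
rewrite [leRHS](@nu_psiw (size w))// (bigD1 (in_tuple w))//= -[leLHS]addr0; apply: lerD.
  rewrite ler_peMl ?fine_measure_ge0//.
  by rewrite invf_ge1 ?weight_gt0// weight_le1.
by apply: sumr_ge0 => w' _; rewrite mulr_ge0 ?fine_measure_ge0// invr_ge0 ltW ?weight_gt0.
Qed.

Lemma energy_psiw_le (w : seq S) f : F f -> E (f \o psiw q w) (f \o psiw q w) <= E f f.
Proof.
move=> Ff; have := mass_psiw_le w Ff measurableT.
by rewrite preimage_setT !mass_total//; [lra|exact: domF_psiw].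
Qed.

(** [energy0_product_bound] is applied with [eta ^ 2 = X]; the factor [E g g] of [X] then cancels,
    so [C] depends on neither [f], [g] nor [B]. *)
Lemma mass_harm_lower : exists2 C : R, 0 <= C & forall f g (B : set borel),
  harm f -> harm g -> 0 < E g g -> measurable B -> mass g B = 0 ->
  E f f <= C * mass f (~` B).
Proof.
have [C C0 HC] := energy0_product_bound; exists C => // f g B hf hg g0 mB gB.
have Ff := harm_dom hf; have Fg := harm_dom hg.
have mC := measurableC mB; set X := mass f (~` B) * E g g.
have X0 : 0 <= X by rewrite mulr_ge0 ?fine_measure_ge0 ?ltW.
have Hw (w : seq S) : `|E (f \o psiw q w) (g \o psiw q w)| <= Num.sqrt X.
  have mwB := psiw_preimage_borel w mB.
  have gwB : mass (g \o psiw q w) (psiw q w @^-1` B) = 0.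
    apply: le_anti; rewrite fine_measure_ge0 andbT -gB.
    exact: mass_psiw_le.
  have := energy_le_of_null (domF_psiw w Ff) (domF_psiw w Fg) mwB gwB.
  rewrite preimage_setC => H; rewrite -sqrtr_sqr ler_wsqrtr//.
  have : mass (f \o psiw q w) (psiw q w @^-1` (~` B)) * E (g \o psiw q w) (g \o psiw q w) <= X.
    apply: ler_pM; [exact: fine_measure_ge0|exact/energy_ge0/domF_psiw| |].
      exact: mass_psiw_le.
    exact: energy_psiw_le.
  by have := sqr_ge0 (E (f \o psiw q w) (g \o psiw q w)); lra.
have wq h a i : harm h -> A a (h \o q) i = h (psi q a (q i)).
  by move=> hh; rewrite /Amap /= -harm_vertices//; exact/psi_in/vertex_in.
have wqq h (a b : S) i : harm h -> A b (A a (h \o q)) i = h (psi q a (psi q b (q i))).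
  move=> hh; rewrite {1}/Amap /= -iota_psi; last exact/psi_in/vertex_in.
  by rewrite -harm_vertices//; exact/psi_in/psi_in/vertex_in.
have := HC (f \o q) (g \o q) (Num.sqrt X).
rewrite sqr_sqrtr// -!energy_harm// => /(_ _ _ _) H.
have {}H : E f f * E g g <= C * X.
  apply: H; first exact: (Hw [::]).
    move=> a; have := Hw [:: a]; rewrite energy_harm; try exact: harm_psiw.
    by congr (`|E0 _ _| <= _); apply/funext => i; rewrite wq.
  move=> a b; have := Hw [:: a; b]; rewrite energy_harm; try exact: harm_psiw.
  by congr (`|E0 _ _| <= _); apply/funext => i; rewrite wqq.
by move: H; rewrite /X mulrA ler_pM2r.
Qed.

(* [cell_mass f w B] plays the role of the energy of [f] carried by the part of
   [B] in the cell of [w]; summing these masses exactly over the words of a given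
   length spares the discussion of intersections of cells. *)
Definition cell_mass f (w : seq S) (B : set borel) : R :=
  (weight r w)^-1 * mass (f \o psiw q w) (psiw q w @^-1` B).

(** The error of the best approximation of [B] by a union of cells of level [m]: a selected cell
    costs its mass outside [B], a rejected one its mass inside. *)
Definition cell_error f m (B : set borel) : R :=
  \sum_(w : m.-tuple S) Num.min (cell_mass f w B) (cell_mass f w (~` B)).

Lemma cell_mass_ge0 f w B : 0 <= cell_mass f w B.
Proof. by rewrite mulr_ge0 ?fine_measure_ge0// invr_ge0 ltW ?weight_gt0. Qed.

Lemma cell_mass_le f w (B C : set borel) : measurable B -> measurable C ->
  B `<=` C -> cell_mass f w B <= cell_mass f w C.
Proof.
move=> mB mC BC; rewrite ler_pM2l ?invr_gt0 ?weight_gt0// fine_measure_le//.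
- exact: psiw_preimage_borel.
- exact: psiw_preimage_borel.
- by move=> x; exact: BC.
Qed.

Lemma cell_massU_le f w (B C : set borel) : measurable B -> measurable C ->
  cell_mass f w (B `|` C) <= cell_mass f w B + cell_mass f w C.
Proof.
move=> mB mC; rewrite -mulrDr ler_pM2l ?invr_gt0 ?weight_gt0// preimage_setU.
by apply: fine_measureU_le; exact: psiw_preimage_borel.
Qed.

Lemma sum_cell_mass f m (B : set borel) : F f -> measurable B ->
  \sum_(w : m.-tuple S) cell_mass f w B = mass f B.
Proof. by move=> Ff mB; rewrite [RHS](nu_psiw m). Qed.

Lemma cell_errorC f m (B : set borel) : cell_error f m (~` B) = cell_error f m B.
Proof. by apply: eq_bigr => w _; rewrite setCK minC. Qed.

Lemma cell_errorU f m (B C : set borel) : measurable B -> measurable C ->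
  cell_error f m (B `|` C) <= cell_error f m B + cell_error f m C.
Proof.
move=> mB mC; rewrite -big_split; apply: ler_sum => w _ /=.
have mBC := measurableU _ _ mB mC.
have H1 := cell_massU_le f w mB mC.
have H2 : cell_mass f w (~` (B `|` C)) <= cell_mass f w (~` B).
  by apply: cell_mass_le; [exact: measurableC..|]; apply: subsetC => x; left.
have H3 : cell_mass f w (~` (B `|` C)) <= cell_mass f w (~` C).
  by apply: cell_mass_le; [exact: measurableC..|]; apply: subsetC => x; right.
have p0 := cell_mass_ge0 f w; move: H1 H2 H3 (p0 B) (p0 C) (p0 (~` B)) (p0 (~` C)).
rewrite ge_min; case: (leP (cell_mass f w B) (cell_mass f w (~` B))) => _;
  case: (leP (cell_mass f w C) (cell_mass f w (~` C))) => _ *;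
  by apply/orP; first [left; lra|right; lra].
Qed.

(** The extra term does not depend on [m]; this allows the passage from finite to countable
    unions. *)
Lemma cell_error_sub f m (B C : set borel) : F f -> measurable B -> measurable C ->
  B `<=` C -> cell_error f m C <= cell_error f m B + mass f (C `\` B).
Proof.
move=> Ff mB mC BC; have mD := measurableD mC mB.
rewrite -(sum_cell_mass m Ff mD) -big_split; apply: ler_sum => w _ /=.
have H1 : cell_mass f w C <= cell_mass f w B + cell_mass f w (C `\` B).
  by rewrite -{1}(setDUK BC); exact: cell_massU_le.
have H2 : cell_mass f w (~` C) <= cell_mass f w (~` B).
  by apply: cell_mass_le; [exact: measurableC..|exact: subsetC].
have p0 := cell_mass_ge0 f w; move: H1 H2 (p0 (C `\` B)).
rewrite ge_min; case: (leP (cell_mass f w B) (cell_mass f w (~` B))) => _ *;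
  by apply/orP; first [left; lra|right; lra].
Qed.

Lemma mass_gap (f : V -> R) (B : (set borel)^nat) (e : R) : (forall n, measurable (B n)) ->
  {homo B : n k / (n <= k)%N >-> (n <= k)%O} -> 0 < e ->
  exists n, mass f ((\bigcup_n B n) `\` B n) < e.
Proof.
move=> mB hB e0.
have mU : measurable (\bigcup_n B n) by exact: bigcupT_measurable.
have /cvgrPdist_lt /(_ e e0) [n _ H] := @fine_measure_nondecreasing (nu f) B mB hB.
exists n; have := H n (leqnn n); rewrite /= ger0_norm; last first.
  by rewrite subr_ge0 fine_measure_le// => x Bx; exists n.
have BU : B n `<=` \bigcup_n B n by move=> x Bx; exists n.
by rewrite -(fine_measureD (nu f) (mB n) mU BU).
Qed.

Lemma cell_error_open f (U : set V) (e : R) : F f -> open U -> 0 < e ->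
  exists m0, forall m, (m0 <= m)%N -> cell_error f m U <= e.
Proof.
move=> Ff oU e0.
(* Points at distance at least [1 / (n + 1)] from the complement of [U]. A cell of smaller diameter
   that is not inside [U] misses [B n], so its share of the error lies in the difference of [U] and
   [B n]. *)
pose B (n : nat) : set borel := [set x | forall y, `|x - y| < n.+1%:R^-1 -> U y].
have mB n : measurable (B n).
  rewrite -[B n]setCK; apply: measurableC; apply: open_borel.
  rewrite (_ : ~` B n = \bigcup_(y in ~` U) ball (y : V) n.+1%:R^-1); last first.
    apply/seteqP; split=> x /=.
      move=> /existsNP[y] /not_implyP[xy nUy]; exists y => //.
      by rewrite -ball_normE /= distrC.
    by move=> [y nUy]; rewrite -ball_normE /= distrC => xy H; apply: nUy; exact: H.
  by apply: bigcup_open => y _; exact: ball_open.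
have hB : {homo B : n k / (n <= k)%N >-> (n <= k)%O}.
  move=> n k nk; apply/subsetPset => x Bx y xy; apply: Bx.
  by apply: lt_le_trans xy _; rewrite lef_pV2 ?posrE ?ltr0n// ler_nat ltnS.
have UE : \bigcup_n B n = U.
  apply/seteqP; split=> [x [n _ Bx]|x Ux].
    by apply: Bx; rewrite subrr normr0 invr_gt0 ltr0n.
  have /nbhs_ballP[dl /= dl0 H] : nbhs x U by exact: open_nbhs_nbhs.
  exists (Num.trunc dl^-1) => // y xy; apply: H; rewrite -ball_normE /=.
  apply: lt_trans xy _; rewrite -[ltRHS]invrK ltf_pV2 ?posrE ?ltr0n ?invr_gt0//.
  exact: truncnS_gt.
have [n Hn] := mass_gap f mB hB e0; rewrite UE in Hn.
have n0 : 0 < n.+1%:R^-1 :> R by rewrite invr_gt0 ltr0n.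
have [m0 small] := cells_small n0; exists m0 => m m0m.
have mU := open_borel oU; have mD := measurableD mU (mB n).
apply: le_trans (ltW Hn); rewrite -(sum_cell_mass m Ff mD); apply: ler_sum => w _.
have [wU|] := pselect (forall x, K x -> U (psiw q w x)).
  apply: le_trans (_ : cell_mass f w (~` U) <= _); first by rewrite ge_min lexx orbT.
  apply: le_trans (cell_mass_ge0 _ _ _); rewrite /cell_mass.
  rewrite (@carried_eq _ _ set0 (nu_carried (domF_psiw w Ff))) ?measure0 ?mulr0//.
    by apply: psiw_preimage_borel; exact: measurableC.
  by rewrite set0I; apply/seteqP; split=> x //= -[nU Kx]; apply: nU; exact: wU.
move=> /existsNP[x0 /not_implyP[Kx0 nUx0]].
apply: le_trans (_ : cell_mass f w U <= _); first by rewrite ge_min lexx.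
rewrite /cell_mass (@carried_eq _ (psiw q w @^-1` U) (psiw q w @^-1` (U `\` B n))
  (nu_carried (domF_psiw w Ff)))//; try exact: psiw_preimage_borel.
apply/seteqP; split=> x /= [Ux Kx]; split=> //; last by case: Ux.
split=> // Bx; apply: nUx0; apply: Bx; exact: small.
Qed.

Lemma cell_error_cvg0 f (B : set borel) (e : R) : F f -> measurable B -> 0 < e ->
  exists m0, forall m, (m0 <= m)%N -> cell_error f m B <= e.
Proof.
move=> Ff mB; move: B mB e.
apply: (@dynkin_induction _ borel (@open V)
  (fun B => forall e : R, 0 < e -> exists m0, forall m, (m0 <= m)%N -> cell_error f m B <= e)
  (erefl _)).
- by move=> B C oB oC; exact: openI.
- by move=> e e0; exact: cell_error_open openT e0.
- by move=> U oU e e0; exact: cell_error_open.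
- by move=> B _ PB e /PB[m0 H]; exists m0 => m /H; rewrite cell_errorC.
- move=> B mB _ PB e e0.
  pose U n : set borel := \big[setU/set0]_(i < n.+1) B i.
  have mU n : measurable (U n) by apply: bigsetU_measurable => i _.
  have e20 : 0 < e / 2 by rewrite divr_gt0.
  have [|n Hn] := mass_gap f mU _ e20.
    by move=> n k nk; apply/subsetPset; apply: subset_bigsetU; rewrite ltnS.
  have UE : \bigcup_n U n = \bigcup_n B n by exact: bigcup_bigsetU_bigcup.
  rewrite UE in Hn.
  have PU k e' : 0 < e' -> exists m0, forall m, (m0 <= m)%N ->
      cell_error f m (\big[setU/set0]_(i < k) B i) <= e'.
    elim: k e' => [|k IH] e' e'0.
      by rewrite big_ord0; apply: cell_error_open => //; exact: open0.
    have e'20 : 0 < e' / 2 by rewrite divr_gt0.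
    have [m1 H1] := IH _ e'20; have [m2 H2] := PB k _ e'20.
    exists (maxn m1 m2) => m; rewrite geq_max => /andP[/H1 {}H1 /H2 {}H2].
    rewrite big_ord_recr /= [e']splitr (le_trans (cell_errorU _ _ _ _))// ?lerD//.
    by apply: bigsetU_measurable => i _.
  have [m0 H0] := PU n.+1 _ e20; exists m0 => m /H0 {}H0.
  have BU : U n `<=` \bigcup_n B n by rewrite -UE => x Ux; exists n.
  rewrite [e]splitr (le_trans (cell_error_sub m Ff (mU n) _ BU))//.
    exact: bigcupT_measurable.
  by rewrite lerD// ltW.
Qed.

(** * Transfer of null sets between energy measures *)

Lemma energy_psi_gt0 (a : S) h : harm h -> 0 < E h h -> 0 < E (h \o psi q a) (h \o psi q a).
Proof.
move=> hh h0; have hha := harm_psi a hh.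
rewrite lt0r energy_ge0 ?andbT; last exact: harm_dom.
apply/eqP; rewrite energy_harm// => /(energy0_eq0 c_gt0) H.
have /bij_inj Ainj := hnd a.
have e : h \o q = fun=> h (psi q a (q ord0)).
  apply: Ainj; apply/funext => i; rewrite Amap_const /Amap /= -harm_vertices//.
    exact: (H i ord0).
  exact/psi_in/vertex_in.
by move: h0; rewrite energy_harm// e energy0_const ltxx.
Qed.

Lemma energy_psiw_gt0 (w : seq S) h : harm h -> 0 < E h h ->
  0 < E (h \o psiw q w) (h \o psiw q w).
Proof.
elim: w h => [//|a w IH] h hh h0 /=.
exact: (IH (h \o psi q a) (harm_psi a hh) (energy_psi_gt0 a hh h0)).
Qed.

Lemma harm_dominated f g (B : set borel) : harm f -> harm g -> 0 < E g g ->
  measurable B -> mass g B = 0 -> mass f B = 0.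
Proof.
move=> hf hg g0 mB gB; have [C C0 HC] := mass_harm_lower.
have Ff := harm_dom hf; have Fg := harm_dom hg; have mC := measurableC mB.
(* If the minimum is the mass of [B] the factor 1 suffices; otherwise [mass_harm_lower] in the cell
   gives [2 * C], the total mass being twice the energy. *)
have bound (w : seq S) : cell_mass f w B <=
    (2 * C + 1) * Num.min (cell_mass f w B) (cell_mass f w (~` B)).
  have wC : cell_mass f w B <= 2 * C * cell_mass f w (~` B).
    rewrite mulrCA ler_pM2l ?invr_gt0 ?weight_gt0//.
    have mw := psiw_preimage_borel w mB.
    have Fw := domF_psiw w Ff.
    apply: le_trans (fine_measure_le (nu _) mw measurableT (@subsetT _ _)) _.
    rewrite mass_total// -mulrA ler_pM2l// -preimage_setC.
    apply: (HC _ (g \o psiw q w)) => //; [exact: harm_psiw|exact: harm_psiw| |].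
      exact: energy_psiw_gt0.
    apply: le_anti; rewrite fine_measure_ge0 andbT -gB.
    exact: mass_psiw_le.
  have p1 := cell_mass_ge0 f w B; have p2 := cell_mass_ge0 f w (~` B).
  have := mulr_ge0 C0 p1.
  by case: (leP (cell_mass f w B) (cell_mass f w (~` B))) => _; rewrite mulrDl mul1r; lra.
apply: le_anti; rewrite fine_measure_ge0 andbT; apply/ler_addgt0Pl => e e0.
rewrite addr0; have C10 : 0 < 2 * C + 1 by lra.
have [m0 Hm] := @cell_error_cvg0 f B (e / (2 * C + 1)) Ff mB (divr_gt0 e0 C10).
rewrite -(sum_cell_mass m0 Ff mB).
apply: le_trans (_ : (2 * C + 1) * cell_error f m0 B <= _).
  by rewrite mulr_sumr; apply: ler_sum => w _; exact: bound.
by rewrite mulrC -ler_pdivlMr//; exact: Hm.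
Qed.

Lemma domF_dominated f g (B : set borel) : F f -> harm g -> 0 < E g g ->
  measurable B -> mass g B = 0 -> mass f B = 0.
Proof.
move=> Ff hg g0 mB gB; have Fg := harm_dom hg.
apply: le_anti; rewrite fine_measure_ge0 andbT; apply/ler_addgt0Pl => e e0.
rewrite addr0.
have e40 : 0 < e / 4 by rewrite divr_gt0.
have /cvgrPdist_lt /(_ _ e40) [m _ /(_ m (leqnn m)) /= Hm] := cvg_energy Ff Ff.
have [phi [Fphi phiE]] := piecewise_harmonic m f.
have harm_w (w : m.-tuple S) : harm (phi \o psiw q w).
  apply: (@eq_harm (iota (f \o psiw q w \o q))); last exact: iota_harm.
  by move=> x Kx /=; rewrite phiE// size_tuple.
have phi_w (w : m.-tuple S) i : phi (psiw q w (q i)) = f (psiw q w (q i)).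
  rewrite phiE ?size_tuple//; last exact: vertex_in.
  by rewrite iota_vertex.
have massphi : mass phi B = 0.
  rewrite (nu_psiw m)// big1// => w _.
  rewrite (@harm_dominated _ (g \o psiw q w)) ?mulr0//.
  - exact: harm_psiw.
  - exact: energy_psiw_gt0.
  - exact: psiw_preimage_borel.
  apply: le_anti; rewrite fine_measure_ge0 andbT -gB.
  exact: mass_psiw_le.
(* On each cell [phi] is the harmonic function with the vertex values of [f], so
   [E phi f = E phi phi = En m f f] and [E h h = E f f - En m f f < e / 4]. As [nu phi] vanishes on
   [B], the masses of [f] and [h] on [B] agree. *)
pose h x := f x + -1 * phi x; have Fh : F h by exact: domFD.
have Eff : E phi f = En m f f.
  rewrite (energy_psiw m Fphi Ff); apply: eq_bigr => w _; congr (_ * _).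
  have Fw := domF_psiw w Ff; have Fpw := domF_psiw w Fphi.
  have -> : E (phi \o psiw q w) (f \o psiw q w) = E (phi \o psiw q w) (phi \o psiw q w).
    have := @harm_orthogonal _ (fun x => (f \o psiw q w) x + -1 * (phi \o psiw q w) x)
      (harm_w w) (domFD _ Fw Fpw).
    rewrite energyDr// => H; apply/eqP; rewrite -subr_eq0 -mulN1r H//.
    by move=> i /=; rewrite phi_w; ring.
  rewrite energy_harm//; congr energy0; apply/funext => i; exact: phi_w.
have Epp : E phi phi = En m f f.
  rewrite (energy_psiw m Fphi Fphi); apply: eq_bigr => w _; congr (_ * _).
  rewrite energy_harm//; congr energy0; apply/funext => i; exact: phi_w.
have Ehh : E h h < e / 4.
  rewrite (energyDl (-1) Ff Fphi Fh) (energyDr (-1) Ff Fphi Ff).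
  rewrite (energyDr (-1) Ff Fphi Fphi) (energyC f phi) Eff Epp.
  by have := ler_norm (E f f - En m f f); lra.
have massh : mass h B < e / 2.
  have := fine_measure_le (nu h) mB measurableT (@subsetT _ _).
  by rewrite mass_total//; lra.
have H1 := nu_quadratic (-1) Ff Fphi mB; rewrite massphi in H1.
have := cross_mass_sqr_le Ff Fphi mB; rewrite massphi mulr0 => cr.
have cr0 : cross_mass f phi B = 0.
  by apply/eqP; rewrite -sqrf_eq0; apply/eqP/le_anti; rewrite cr sqr_ge0.
move: massh; rewrite /h H1 cr0 !mulr0 !addr0; lra.
Qed.

End Gasket.

Theorem theorem5p6 (R : realType) (d l : nat) (hd : (2 <= d)%N) (hl : (2 <= l)%N)
    (q : 'I_d.+1 -> 'rV[R]_d) (hq : regular_simplex q)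
    (K : set 'rV[R]_d) (hK : is_gasket l q K)
    (c : R) (r : label d l -> R)
    (hr : canonical_harmonic_structure q K c r)
    (hnd : nondegenerate_form q K c r)
    (nu : ('rV[R]_d -> R) -> {finite_measure set (borelV R d) -> \bar R})
    (hnu : forall f, domF q K c r f -> is_energy_measure q K c r f (nu f)) :
  (forall h, harmonic_function q K c r h -> nonconstant_on K h ->
     Fdom q K c r nu h) /\
  (forall h1 h2, harmonic_function q K c r h1 -> nonconstant_on K h1 ->
     harmonic_function q K c r h2 -> nonconstant_on K h2 ->
     nu h1 `<< nu h2 /\ nu h2 `<< nu h1).
Proof.
have [s s0 hs] := hq.
have key f h (A : set (borelV R d)) : domF q K c r f -> harmonic_function q K c r h ->
    nonconstant_on K h -> measurable A -> nu h A = 0%E -> nu f A = 0%E.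
  move=> Ff hh hnc mA hA; have Fh : domF q K c r h by case: hh.
  rewrite finite_measureE//; congr (_%:E).
  apply: (domF_dominated hd hl s0 hs hK hr hnd hnu (g := h)) => //.
    rewrite lt0r (energy_ge0 hr Fh) andbT; apply/eqP => E0; apply: hnc.
    by exists (h (q ord0)) => x Kx; exact: (energy_eq0 hd hl s0 hs hK hr Fh E0 Kx).
  by rewrite hA.
have dom f h : domF q K c r f -> harmonic_function q K c r h -> nonconstant_on K h ->
    nu f `<< nu h.
  move=> Ff hh hnc; apply/null_content_dominatesP => A mA hA.
  exact: key hA.
split=> [h hh hnc|h1 h2 hh1 hnc1 hh2 hnc2]; last first.
  by split; apply: dom => //; case: hh1 hh2 => ? _ [].
have Fh : domF q K c r h by case: hh.
split=> //; split.
- by case: (hnu h Fh).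
- by move=> f Ff; exact: dom.
(* Minimality: an energy-dominant [m'] dominates in particular [nu h], as [h] is in the domain. *)
- by move=> m' _; apply.
Qed.
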